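(* Let $K$ be a Lie group modeled on a locally convex space, let $\mathcal{P}=(K,\eta:P\to M)$ and $\mathcal{P}'=(K,\eta':P'\to M)$ be smooth principal $K$-bundles over the finite-dimensional connected paracompact manifold with corners $M$, and let $\Omega:P\to P'$ be a continuous bundle equivalence. If $C\subseteq M$ is closed and $\Omega$ is smooth on an open neighborhood of $\eta^{-1}(C)$, then there exist an open neighborhood $T$ of $C$ and a smooth bundle equivalence $\widetilde\Omega:P\to P'$ with $\Omega|_{\eta^{-1}(T)}=\widetilde\Omega|_{\eta^{-1}(T)}$.
   Context: Calculus. Locally convex spaces are real and Hausdorff. For $E,F$ locally convex and $U\subseteq E$ open, a map $f:U\to F$ is $C^1$ if it is continuous, $df(x).v:=\lim_{h\to 0}\frac1h(f(x+hv)-f(x))$ exists for all $x\in U$, $v\in E$, and $df:U\times E\to F$ is continuous. Recursively, $d^{n}f(x).(v_1,\dots,v_n):=\lim_{h\to0}\frac1h\big(d^{n-1}f(x+hv_n).(v_1,\dots,v_{n-1})-d^{n-1}f(x).(v_1,\dots,v_{n-1})\big)$; $f$ is $C^n$ if $d^kf:U\times E^k\to F$ exists and is continuous for $k=1,\dots,n$, and smooth if it is $C^n$ for all $n$. A Lie group modeled on a locally convex space is a group that is a smooth manifold modeled on a locally convex space with smooth group operations. Manifolds with corners. A map $f:A\to E$ from a (not necessarily open) subset $A\subseteq\mathbb{R}^n$ is smooth if each $x\in A$ has an open neighborhood $U_x$ in $\mathbb{R}^n$ and a smooth map $f_x:U_x\to E$ agreeing with $f$ on $A\cap U_x$. A $d$-dimensional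 manifold with corners is a paracompact Hausdorff space in which each point has a neighborhood homeomorphic to an open subset of $\mathbb{R}^d_+=\{x\in\mathbb{R}^d:x_i\ge0 \text{ for all } i\}$, with smooth coordinate changes. Bundles. A continuous principal $K$-bundle over $M$ is a topological space $P$ with a continuous right action $P\times K\to P$ and a map $\eta:P\to M$ such that there are an open cover $(U_i)_{i\in I}$ of $M$ (a locally trivial cover) and homeomorphisms (local trivializations) $\Omega_i:\eta^{-1}(U_i)\to U_i\times K$ with $\mathrm{pr}_1\circ\Omega_i=\eta|_{\eta^{-1}(U_i)}$ and $\Omega_i(p\cdot k)=\Omega_i(p)\cdot k$, where $K$ acts on $U_i\times K$ by right multiplication on the second factor. The transition functions $k_{ij}:U_i\cap U_j\to K$ are the continuous maps given by $\Omega_i^{-1}(x,e)\cdot k_{ij}(x)=\Omega_j^{-1}(x,e)$. The bundle is smooth if the transition functions are smooth for some choice of local trivializations; then $P$ carries the smooth structure for which these $\Omega_i$ are diffeomorphisms. A continuous bundle map $\Omega:P\to P'$ is a continuous map with $\Omega(p\cdot k)=\Omega(p)\cdot k$; it is a continuous bundle equivalence if it is an isomorphism inducing $\mathrm{id}_M$ on $M$. A smooth bundle equivalence between smooth bundles is a bundle equivalence that is smooth for the smooth structures just described. *)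

(* Defs.v *)
From HB Require Import structures.
From mathcomp Require Import all_boot all_order all_algebra.
From mathcomp Require Import boolp classical_sets cardinality reals topology normedtype.
Import GRing.Theory Num.Theory.
Import numFieldNormedType.Exports.

Set Implicit Arguments.
Unset Strict Implicit.
Unset Printing Implicit Defensive.

Local Open Scope classical_set_scope.
Local Open Scope ring_scope.

(* ** Calculus in locally convex spaces (Michal-Bastiani).  Maps defined on a
   subset of E are represented by total functions, constrained only on that
   subset. *)

Section Calculus.
Context {R : realType} {E F : tvsType R}.
Implicit Types (f g : E -> F) (U A : set E).

Definition is_dir_deriv f (x v : E) (l : F) :=
  h^-1 *: (f (x + h *: v) - f x) @[h --> (0 : R)^'] --> l.

(* The limit if it exists, 0 otherwise. *)
Definition dir_deriv f (x v : E) : F := xget 0 (is_dir_deriv f x v).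

(* d^n f(x).(v_1, ..., v_n); v_k is [v] at the ordinal k - 1. *)
Fixpoint iter_diff f (n : nat) : E -> ('I_n -> E) -> F :=
  match n with
  | 0 => fun x _ => f x
  | m.+1 => fun x v =>
      dir_deriv (fun y => @iter_diff f m y (fun i => v (widen_ord (leqnSn m) i)))
        x (v ord_max)
  end.

Definition Cn (n : nat) U f :=
  (forall k x (v : 'I_k.+1 -> E), (k < n)%N -> U x ->
     exists l,
       is_dir_deriv (fun y => iter_diff f y (fun i => v (widen_ord (leqnSn k) i)))
         x (v ord_max) l) /\
  (forall k x (v : {ptws 'I_k -> E}), (k <= n)%N -> U x ->
     {for (x, v), continuous (fun z : E * {ptws 'I_k -> E} =>
                                iter_diff f z.1 z.2)}).

(* Smoothness on a subset that need not be open: local extendability.  For open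
   [A] this is equivalent to being C^n on [A] for all n, C^n being local. *)
Definition smooth_on A f :=
  forall x, A x -> exists U (g : E -> F),
    [/\ open U, U x, (forall n, Cn n U g) & forall y, A y -> U y -> f y = g y].

End Calculus.

(* ** Manifolds. *)

(* A chart has domain [cdom] and coordinate map [cfwd]; [cbwd] is the inverse of
   [cfwd], relevant only on [cfwd @` cdom]. *)
Record chart {R : realType} (X : topologicalType) (E : tvsType R) := Chart {
  cdom : set X;
  cfwd : X -> E;
  cbwd : E -> X }.

Section Manifolds.
Context {R : realType}.

(* [c] is a homeomorphism from an open subset of X to an open subset of Q. *)
Definition is_chart {X : topologicalType} {E : tvsType R} (Q : set E)
    (c : chart X E) :=
  [/\ open (cdom c),
      (exists2 V, open V & cfwd c @` cdom c = V `&` Q),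
      (forall x, cdom c x -> cbwd c (cfwd c x) = x),
      {within cdom c, continuous (cfwd c)} &
      {within cfwd c @` cdom c, continuous (cbwd c)}].

Definition is_atlas {X : topologicalType} {E : tvsType R} (Q : set E)
    (A : set (chart X E)) :=
  [/\ (forall c, A c -> is_chart Q c),
      (forall x, exists2 c, A c & cdom c x) &
      (forall c c', A c -> A c' ->
         smooth_on (cfwd c @` (cdom c `&` cdom c')) (cfwd c' \o cbwd c))].

(* [f] is smooth on [W] (meant to be open). *)
Definition smooth_map_on {X Y : topologicalType} {E F : tvsType R}
    (A : set (chart X E)) (B : set (chart Y F)) (W : set X) (f : X -> Y) :=
  {within W, continuous f} /\
  forall c c', A c -> B c' ->
    smooth_on (cfwd c @` (W `&` cdom c `&` f @^-1` cdom c'))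
              (cfwd c' \o f \o cbwd c).

Definition prod_chart {X Y : topologicalType} {E F : tvsType R}
    (c : chart X E) (c' : chart Y F) : chart (X * Y)%type (E * F)%type :=
  Chart (cdom c `*` cdom c')
        (fun z => (cfwd c z.1, cfwd c' z.2))
        (fun w => (cbwd c w.1, cbwd c' w.2)).

Definition prod_atlas {X Y : topologicalType} {E F : tvsType R}
    (A : set (chart X E)) (B : set (chart Y F)) :
    set (chart (X * Y)%type (E * F)%type) :=
  [set ch | exists c c', [/\ A c, B c' & ch = prod_chart c c']].

Definition is_manifold {X : topologicalType} {E : tvsType R}
    (A : set (chart X E)) :=
  hausdorff_space X /\ is_atlas [set: E] A.

Definition locally_finite {X : topologicalType} (V : set (set X)) :=
  forall x : X, exists2 N, nbhs x N & finite_set [set B | V B /\ B `&` N !=set0].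

Definition open_cover {X : topologicalType} (V : set (set X)) :=
  (forall B, V B -> open B) /\ \bigcup_(B in V) B = [set: X].

Definition paracompact (X : topologicalType) :=
  forall V : set (set X), open_cover V ->
    exists V' : set (set X), [/\ open_cover V', locally_finite V' &
      forall B', V' B' -> exists2 B, V B & B' `<=` B].

Definition orthant (d : nat) : set 'rV[R]_d :=
  [set x | forall i, 0 <= x ord0 i].

Definition is_manifold_with_corners {d : nat} {X : topologicalType}
    (A : set (chart X 'rV[R]_d)) :=
  [/\ hausdorff_space X, paracompact X & is_atlas (@orthant d) A].

End Manifolds.

(* ** Lie groups.  The structure below merely joins a group law and a topology;
   their compatibility is part of [is_lie_group]. *)

#[short(type="preTopologicalGroupType")]
HB.structure Definition PreTopologicalGroup := {K of Topological K & Group K}.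

Definition is_lie_group {R : realType} {E : tvsType R}
    {K : preTopologicalGroupType} (A : set (chart K E)) :=
  [/\ is_manifold A,
      smooth_map_on (prod_atlas A A) A setT (fun z : K * K => (z.1 * z.2)%g) &
      smooth_map_on A A setT (fun x : K => (x^-1)%g)].

(* ** Principal bundles. *)

(* A local trivialization eta^-1(U) -> U x K, with U = [tdom]; the values of
   [tfwd] outside eta^-1(U) and of [tbwd] outside U x K are irrelevant. *)
Record triv (M P : topologicalType) (K : preTopologicalGroupType) := Triv {
  tdom : set M;
  tfwd : P -> M * K;
  tbwd : M * K -> P }.

Definition is_triv {M P : topologicalType} {K : preTopologicalGroupType}
    (eta : P -> M) (act : P -> K -> P) (t : triv M P K) :=
  [/\ open (tdom t),
      (forall p, tdom t (eta p) -> (tfwd t p).1 = eta p),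
      (forall p k, tdom t (eta p) -> tdom t (eta (act p k)) /\
         tfwd t (act p k) = ((tfwd t p).1, (tfwd t p).2 * k)%g),
      ((forall p, tdom t (eta p) -> tbwd t (tfwd t p) = p) /\
       (forall x k, tdom t x -> tdom t (eta (tbwd t (x, k))) /\
         tfwd t (tbwd t (x, k)) = (x, k))) &
      {within eta @^-1` tdom t, continuous (tfwd t)} /\
      {within tdom t `*` [set: K], continuous (tbwd t)}].

(* Continuity of [proj] makes the sets eta^-1(U) open in the total space, so that
   they can serve as domains of charts. *)
Record principal_bundle (M : topologicalType) (K : preTopologicalGroupType) :=
  PrincipalBundle {
  total :> topologicalType;
  proj : total -> M;
  act : total -> K -> total;
  proj_continuous : continuous proj;
  act_continuous : continuous (fun z : total * K => act z.1 z.2);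
  act1 : forall p, act p 1%g = p;
  actM : forall p k l, act p (k * l)%g = act (act p k) l;
  locally_trivial : forall x, exists2 t, is_triv proj act t & tdom t x }.

Arguments proj {M K}.
Arguments act {M K} _ _ _.

Section Bundles.
Context {R : realType} {E F : tvsType R} {M : topologicalType}
  {K : preTopologicalGroupType}.
Variables (AM : set (chart M E)) (AK : set (chart K F)).

(* A smooth bundle carries the local trivializations, with smooth transition
   functions, that define its smooth structure. *)
Record smooth_bundle := SmoothBundle {
  bundle :> principal_bundle M K;
  trivs : set (triv M bundle K);
  trivs_triv : forall t, trivs t -> is_triv (proj bundle) (act bundle) t;
  trivs_cover : forall x, exists2 t, trivs t & tdom t x;
  trivs_smooth : forall s t, trivs s -> trivs t -> exists k : M -> K,
    (forall x, tdom s x -> tdom t x ->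
       act bundle (tbwd s (x, 1%g)) (k x) = tbwd t (x, 1%g)) /\
    smooth_map_on AM AK (tdom s `&` tdom t) k }.

Definition triv_chart (P : principal_bundle M K) (t : triv M P K)
    (ch : chart (M * K)%type (E * F)%type) : chart P (E * F)%type :=
  Chart [set p | tdom t (proj P p) /\ cdom ch (tfwd t p)]
        (cfwd ch \o tfwd t) (tbwd t \o cbwd ch).

(* The atlas for which the given trivializations are diffeomorphisms. *)
Definition bundle_atlas (P : smooth_bundle) : set (chart P (E * F)%type) :=
  [set c | exists t ch,
    [/\ trivs t, prod_atlas AM AK ch & c = triv_chart t ch]].

Arguments bundle_atlas P : clear implicits.

Definition bundle_map (P P' : principal_bundle M K) (Om : P -> P') :=
  continuous Om /\ forall p k, Om (act P p k) = act P' (Om p) k.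

Definition bundle_equivalence (P P' : principal_bundle M K) (Om : P -> P') :=
  [/\ bundle_map Om,
      (exists Om' : P' -> P, [/\ bundle_map Om', cancel Om Om' & cancel Om' Om]) &
      forall p, proj P' (Om p) = proj P p].

Definition smooth_bundle_equivalence (P P' : smooth_bundle) (Om : P -> P') :=
  bundle_equivalence Om /\
  smooth_map_on (bundle_atlas P) (bundle_atlas P') setT Om.

End Bundles.

Arguments bundle_atlas {R E F M K AM AK} P.

(* Main.v *)
Require Import Defs.
From mathcomp Require Import all_boot all_order all_algebra.
From mathcomp Require Import boolp classical_sets cardinality reals.
From mathcomp Require Import topology normedtype convex sequences exp.
From mathcomp Require Import interval_inference ring lra.
Import Order.TTheory GRing.Theory Num.Theory.
Import numFieldNormedType.Exports.

(** The idea. Over a set which trivializes both bundles, a bundle map over the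
    identity is the same thing as a K-valued function, its local representative,
    and it is smooth exactly where this function is (local_rep, of_local_rep).
    If the function takes values in a chart of K with convex image, it may be
    averaged with constants: (1 - l) f + l c, with l a smooth bump function on
    the base, is smooth wherever f is smooth and wherever l = 1, and it differs
    from f only on the support of l. Finitely many such averages make f smooth
    near a compact set, and convexity keeps the result as close to f as desired
    (smoothing_on_compact).

    The base carries a locally finite cover by relatively compact open sets over
    which Om takes values in convex charts (adapted_set_near, refine_cover), and
    this cover shrinks to a cover by closed sets (shrink_cover). The members are
    treated one after the other. Being in a given convex chart over a compact set
    is an open condition on the map, so a small modification over one member
    respects it for the finitely many members nearby (smoothing_step); thus the
    process never leaves the charts in which it takes place. No step destroys
    smoothness, and no step changes the map over the closure of a neighborhood T
    of C, over which Om is smooth from the start. Local finiteness makes the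
    process stabilize near every point, so it can be continued through all
    members by maximality among the partial results (globalize_smoothing). The
    final map is a smooth morphism, hence an equivalence
    (bundle_morphism_equivalence).

    Two foundations are laid first. Composition of smooth maps between locally
    convex spaces rests on a mean value theorem for convex neighborhoods
    (curve_mean_value), which gives strict differentiability and thereby the
    linearity of differentials and the chain rule. The class Cn, given by iterated
    directional derivatives, is then identified with the class TCn, given by
    iterated tangent maps, for which closure under composition is an induction
    (TCn_Cn, Cn_TCn). Smoothness between manifolds is reformulated pointwise, for
    atlases of a weak kind which include those of the total spaces (smooth_at,
    good_atlas, bundle_good_atlas). *)

Set Implicit Arguments.
Unset Strict Implicit.
Unset Printing Implicit Defensive.

Local Open Scope classical_set_scope.
Local Open Scope ring_scope.

(** * Mean values in locally convex spaces *)

Lemma cvg_pair_nbhs {T : Type} {U V : topologicalType} {G : set_system T}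
    {FG : Filter G} (f : T -> U) (g : T -> V) (a : U) (b : V) :
  f @ G --> a -> g @ G --> b -> (fun x => (f x, g x)) @ G --> (a, b).
Proof. by move=> fa gb; exact: (@cvg_pair _ _ _ _ (nbhs a) (nbhs b)). Qed.

Section ContinuousOperations.
Context {R : realType} {V : tvsType R} {T : Type} {G : set_system T} {FG : Filter G}.

Lemma tvs_cvgD (f g : T -> V) a b :
  f @ G --> a -> g @ G --> b -> (fun x => f x + g x) @ G --> a + b.
Proof.
move=> fa gb.
exact: (cvg_comp _ _ (cvg_pair_nbhs fa gb) (@add_continuous V (a, b))).
Qed.

Lemma tvs_cvgZ (k : T -> R) (f : T -> V) (l : R) a :
  k @ G --> l -> f @ G --> a -> (fun x => k x *: f x) @ G --> l *: a.
Proof.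
move=> kl fa.
exact: (cvg_comp _ _ (@cvg_pair_nbhs _ R^o _ _ _ _ _ _ _ kl fa)
  (@scale_continuous R V (l, a))).
Qed.

Lemma tvs_cvgN (f : T -> V) a :
  f @ G --> a -> (fun x => - f x) @ G --> - a.
Proof.
move=> fa; have -> : (fun x => - f x) = (fun x => (-1 : R) *: f x).
  by apply/funext => x; rewrite scaleN1r.
by rewrite -(scaleN1r a); exact: (tvs_cvgZ (cvg_cst (-1 : R)) fa).
Qed.

Lemma tvs_cvgB (f g : T -> V) a b :
  f @ G --> a -> g @ G --> b -> (fun x => f x - g x) @ G --> a - b.
Proof. by move=> fa gb; exact: (tvs_cvgD fa (tvs_cvgN gb)). Qed.

End ContinuousOperations.

Definition is_convex {R : realType} {V : tvsType R} (N : set V) :=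
  forall a b (s t : R), N a -> N b -> 0 <= s -> 0 <= t -> s + t = 1 ->
  N (s *: a + t *: b).

Lemma convex_nbhs {R : realType} {V : tvsType R} (x : V) (A : set V) :
  nbhs x A -> exists N, [/\ open N, N x, is_convex N & N `<=` A].
Proof.
have [B Bc [Bo Bx]] := @locally_convex R V.
move=> /(Bx x) [N [BN Nx] NA]; exists N; split => //; first exact: Bo.
move=> a b s t Na Nb s0 t0 st.
have s1 : s <= 1 by rewrite -st lerDl.
have := Bc N; rewrite inE => /(_ BN).
have si : Itv.spec (@Itv.num_sem R) (Itv.Real `[0%Z, 1%Z]) s.
  by apply/andP; split; [exact: ger0_real|rewrite /= in_itv /= s0 s1].
move=> /(_ a b (Itv.mk si)); rewrite !inE => /(_ Na Nb).
rewrite /conv /= /unstable.onem.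
by have -> : 1 - s = t by rewrite -st addrC addKr.
Qed.

(** Real induction: the supremum of the points that G reaches from 0 is itself
    reached, by the hypothesis near it, and the same hypothesis carries G further
    unless the supremum is 1. *)
Lemma unit_interval_chain {R : realType} (G : R -> R -> Prop) :
  (forall a b c, 0 <= a -> a <= b -> b <= c -> c <= 1 -> G a b -> G b c -> G a c) ->
  (forall s, 0 <= s -> s <= 1 -> exists2 d, 0 < d &
     forall a b, 0 <= a -> a <= s -> s <= b -> b <= 1 -> s - d < a -> b < s + d ->
     G a b) ->
  G 0 1.
Proof.
move=> Gt Gl.
pose A := [set x | [/\ 0 <= x, x <= 1 & G 0 x]].
have A0 : A 0.
  have [d d0 p] := Gl 0 (lexx _) ler01.
  by split => //; apply: p => //; lra.
have supA : has_sup A by split; [exists 0|exists 1 => x []].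
have ubA x : A x -> x <= sup A by apply: ub_le_sup; exact: (proj2 supA).
have s0 : 0 <= sup A by exact: ubA.
have s1 : sup A <= 1 by apply: ge_sup; [exists 0|move=> x []].
have [d d0 Gd] := Gl _ s0 s1.
have [x [x0 x1 Gx] dx] := sup_adherent d0 supA.
have xs : x <= sup A by apply: ubA; split.
have key y : sup A <= y -> y <= 1 -> y < sup A + d -> G 0 y.
  by move=> sy y1 yd; apply: (Gt 0 x y) => //; [lra|exact: Gd].
have [sA1|sA1] := leP 1 (sup A); first by apply: key; lra.
pose y := Num.min 1 (sup A + d / 2).
(* y would exceed the supremum of A *)
have yA : A y.
  split; rewrite /y.
  - by rewrite le_min ler01 /=; lra.
  - by rewrite ge_min lexx.
  - apply: key.
    + by rewrite le_min s1 /=; lra.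
    + by rewrite ge_min lexx.
    + by rewrite gt_min; apply/orP; right; lra.
have : y <= sup A by exact: ubA.
by rewrite /y ge_min => /orP[]; lra.
Qed.

Section MeanValue.
Context {R : realType} {E F : tvsType R}.

(** A mean value theorem that needs no continuous functionals. Difference
    quotients in N over adjacent intervals combine to one in N because N is
    convex, and over short intervals they lie in N because N is open. *)
Lemma curve_mean_value (c : R -> F) (N : set F) : open N -> is_convex N ->
  (forall s, 0 <= s -> s <= 1 -> exists2 l, N l &
     h^-1 *: (c (s + h) - c s) @[h --> (0 : R)^'] --> l) ->
  N (c 1 - c 0).
Proof.
move=> oN cN cd.
pose G a b := exists2 n, N n & c b - c a = (b - a) *: n.
have Gt a b e : a <= b -> b <= e -> G a b -> G b e -> G a e.
  move=> ab be [n1 N1 e1] [n2 N2 e2].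
  have [ea|ae] := eqVneq e a.
    have ba : b = a by apply/eqP; rewrite eq_le ab -ea be.
    by rewrite ea; exists n1 => //; rewrite !subrr scale0r.
  have ae0 : 0 < e - a by rewrite subr_gt0 lt_neqAle eq_sym ae (le_trans ab be).
  have ane : e - a != 0 by rewrite gt_eqF.
  exists (((b - a) / (e - a)) *: n1 + ((e - b) / (e - a)) *: n2).
    apply: cN => //; rewrite ?divr_ge0 ?subr_ge0 ?(ltW ae0)//.
      by rewrite ltW// -subr_gt0.
      by rewrite ltW// -subr_gt0.
    by rewrite -mulrDl addrC addrA subrK divff.
  rewrite scalerDr !scalerA ![(e - a) * _]mulrC !divfK// -e1 -e2.
  by rewrite [RHS]addrC addrA subrK.
suff [n Nn] : G 0 1 by rewrite subr0 scale1r => ->.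
apply: unit_interval_chain => [a b e _ ab be _|s s0 s1]; first exact: Gt.
have [l Nl cl] := cd s s0 s1.
have : nbhs l N by exact: open_nbhs_nbhs.
move=> /cl [d /= d0 dN].
exists d => // a b a0 as_ sb b1 da bd.
apply: (Gt a s b) => //.
  move: as_; rewrite le_eqVlt => /orP[/eqP ->|as_].
    by exists l => //; rewrite !subrr scale0r.
  exists ((a - s)^-1 *: (c (s + (a - s)) - c s)).
    apply: dN; last by rewrite subr_eq0 lt_eqF.
    by rewrite /ball /= sub0r normrN ltr0_norm; lra.
  rewrite [s + _]addrC subrK scalerA -(opprB a s) mulNr mulfV ?subr_eq0 ?lt_eqF//.
  by rewrite scaleN1r opprB.
move: sb; rewrite le_eqVlt => /orP[/eqP <-|sb].
  by exists l => //; rewrite !subrr scale0r.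
exists ((b - s)^-1 *: (c (s + (b - s)) - c s)).
  apply: dN; last by rewrite subr_eq0 gt_eqF.
  by rewrite /ball /= sub0r normrN gtr0_norm; lra.
by rewrite [s + _]addrC subrK scalerA mulfV ?scale1r// subr_eq0 gt_eqF.
Qed.

Lemma cvg_dnbhs_scale (t : R) : t != 0 -> (fun h => t * h) @ (0 : R)^' --> (0 : R)^'.
Proof.
move=> t0 A [d /= d0 dA]; exists (d / `|t|) => /=.
  by rewrite divr_gt0// normr_gt0.
move=> h; rewrite /= sub0r normrN => hd h0; apply: dA => /=.
  by rewrite sub0r normrN normrM mulrC -ltr_pdivlMr// normr_gt0.
by rewrite mulf_neq0.
Qed.

Lemma segment_mean_value (f : E -> F) (y q : E) (t : R) (N : set F) :
  t != 0 -> open N -> is_convex N ->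
  (forall s, 0 <= s -> s <= 1 -> exists2 l, N l &
     is_dir_deriv f (y + (s * t) *: q) q l) ->
  N (t^-1 *: (f (y + t *: q) - f y)).
Proof.
move=> t0 oN cN fd.
have := @curve_mean_value (fun s => t^-1 *: f (y + (s * t) *: q)) N oN cN.
rewrite mul1r mul0r scale0r addr0 -scalerBr; apply => s s0 s1.
have [l Nl fl] := fd s s0 s1; exists l => //.
have -> : (fun h : R => h^-1 *: (t^-1 *: f (y + ((s + h) * t) *: q) -
    t^-1 *: f (y + (s * t) *: q))) =
  (fun h => h^-1 *: (f (y + (s * t) *: q + h *: q) - f (y + (s * t) *: q)))
  \o (fun h => t * h).
  apply/funext => h /=.
  by rewrite -scalerBr scalerA invfM mulrC mulrDl scalerDl [t * h]mulrC addrA.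
exact: cvg_comp (cvg_dnbhs_scale t0) fl.
Qed.

(** Base point, direction and step size may move at the same time. This is what
    makes the differential additive and what proves the chain rule. *)
Lemma strict_diff (f : E -> F) (df : E * E -> F) (U : set E) (y0 q0 : E)
    {T : Type} (G : set_system T) {FG : Filter G}
    (y q : T -> E) (t : T -> R) :
  open U -> U y0 -> (forall x v, U x -> is_dir_deriv f x v (df (x, v))) ->
  {for (y0, q0), continuous df} ->
  y @ G --> y0 -> q @ G --> q0 -> t @ G --> (0 : R) -> (\forall i \near G, t i != 0) ->
  (fun i => (t i)^-1 *: (f (y i + t i *: q i) - f (y i))) @ G --> df (y0, q0).
Proof.
move=> oU Uy0 fd cdf cy cq ct tn A /convex_nbhs[N [oN Nl cN NA]].
pose W := [set z : R^o * (E * E) | U (z.2.1 + z.1 *: z.2.2) /\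
                           N (df (z.2.1 + z.1 *: z.2.2, z.2.2))].
have : nbhs (0 : R^o, (y0, q0)) W.
  have c1 : (fun z : R^o * (E * E) => z.2.1 + z.1 *: z.2.2) @ (0 : R^o, (y0, q0)) --> y0.
    rewrite -[X in _ --> X]addr0 -(scale0r q0).
    apply: tvs_cvgD; first by apply: (@cvg_comp _ _ _ snd fst); [exact: cvg_snd|exact: cvg_fst].
    apply: tvs_cvgZ; first exact: cvg_fst.
    by apply: (@cvg_comp _ _ _ snd snd); [exact: cvg_snd|exact: cvg_snd].
  apply: filterI.
    by apply: c1; exact: open_nbhs_nbhs.
  have c2 : (fun z : R^o * (E * E) => (z.2.1 + z.1 *: z.2.2, z.2.2)) @
      (0 : R^o, (y0, q0)) --> (y0, q0).
    apply: cvg_pair_nbhs; first exact: c1.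
    by apply: (@cvg_comp _ _ _ snd snd); [exact: cvg_snd|exact: cvg_snd].
  by apply: (cvg_comp _ _ c2 cdf); exact: open_nbhs_nbhs.
case=> -[/= D Z] [/= D0 Z0] DZW.
(* step sizes range over a ball, which with t contains s * t for 0 <= s <= 1 *)
case: D0 => d /= d0 dD.
have c3 : (fun i => (y i, q i)) @ G --> (y0, q0) by exact: cvg_pair_nbhs.
have td : \forall i \near G, `|t i| < d.
  by move/cvgrPdist_lt: ct => /(_ d d0); apply: filterS => i; rewrite sub0r normrN.
suff : \forall i \near G, A ((t i)^-1 *: (f (y i + t i *: q i) - f (y i))) by [].
near=> i; apply: NA.
apply: (@segment_mean_value f (y i) (q i) (t i) N) => //; first by near: i.
move=> s s0 s1.
have [] : W (s * t i, (y i, q i)).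
  apply: DZW; split => /=; last by near: i; exact: c3.
  apply: dD; rewrite /ball /= sub0r normrN normrM (ger0_norm s0).
  apply: (@le_lt_trans _ _ `|t i|); first by rewrite ler_piMl.
  by near: i.
move=> /= W1 W2; exists (df (y i + (s * t i) *: q i, q i)) => //.
exact: fd.
Unshelve. all: by end_near. Qed.

End MeanValue.

(** * Directional derivatives and the chain rule *)

Lemma cvg_ext {T : Type} {U : topologicalType} (F : set_system T) (f g : T -> U)
    (l : U) : f =1 g -> f @ F --> l -> g @ F --> l.
Proof. by move=> /funext ->. Qed.

Section DirectionalDerivatives.
Context {R : realType} {E F : tvsType R}.
Implicit Types (f g : E -> F).

Lemma cvg_line (x v : E) : (fun h : R => x + h *: v) @ (0 : R)^' --> x.
Proof.
rewrite -[X in _ --> X]addr0 -(scale0r v).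
apply: tvs_cvgD; first exact: cvg_cst.
apply: tvs_cvgZ; last exact: cvg_cst.
by apply: cvg_within_filter; exact: cvg_id.
Qed.

Lemma is_dir_deriv_near f g x v l : (\forall y \near x, f y = g y) ->
  is_dir_deriv f x v l -> is_dir_deriv g x v l.
Proof.
move=> fg; apply: cvg_trans; apply: near_eq_cvg.
have fgx : f x = g x by exact: nbhs_singleton fg.
have H : \forall h \near (0 : R)^', f (x + h *: v) = g (x + h *: v).
  exact: (@cvg_line x v _ fg).
by apply: filterS H => h /= ->; rewrite fgx.
Qed.

Lemma is_dir_deriv_ext f g x v l : f =1 g ->
  is_dir_deriv f x v l -> is_dir_deriv g x v l.
Proof. by move=> /funext ->. Qed.

Lemma is_dir_deriv_unique f x v l l' : hausdorff_space F ->
  is_dir_deriv f x v l -> is_dir_deriv f x v l' -> l = l'.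
Proof. by move=> hF; exact: (@cvg_unique _ hF). Qed.

Lemma dir_derivE f x v l : hausdorff_space F ->
  is_dir_deriv f x v l -> dir_deriv f x v = l.
Proof.
move=> hF fl; apply: (is_dir_deriv_unique hF _ fl).
exact: (@xgetPex _ 0 (is_dir_deriv f x v) (ex_intro _ l fl)).
Qed.

Lemma is_dir_derivD f g x v l m : is_dir_deriv f x v l -> is_dir_deriv g x v m ->
  is_dir_deriv (fun y => f y + g y) x v (l + m).
Proof.
move=> fl gm; apply: cvg_ext (tvs_cvgD fl gm) => h /=.
by rewrite -scalerDr opprD addrACA.
Qed.

Lemma is_dir_derivZ f x v l (a : R) : is_dir_deriv f x v l ->
  is_dir_deriv (fun y => a *: f y) x v (a *: l).
Proof.
move=> fl; apply: cvg_ext (tvs_cvgZ (cvg_cst a) fl) => h /=.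
by rewrite scalerA mulrC -scalerA scalerBr.
Qed.

Lemma is_dir_deriv_cst (c : F) x v : is_dir_deriv (fun _ : E => c) x v 0.
Proof.
apply: cvg_near_cst; apply: nearW => h /=.
by rewrite subrr scaler0.
Qed.

End DirectionalDerivatives.

Definition clinear {R : realType} {E F : tvsType R} (l : E -> F) :=
  continuous l /\ forall (a : R) x y, l (a *: x + y) = a *: l x + l y.

Section ContinuousLinear.
Context {R : realType} {E F G : tvsType R}.

Lemma clin0 (l : E -> F) : clinear l -> l 0 = 0.
Proof.
case=> _ /(_ 1 0 0); rewrite !scale1r addr0 => /eqP.
by rewrite -subr_eq0 opprD addNKr oppr_eq0 => /eqP.
Qed.

Lemma clinZ (l : E -> F) (a : R) x : clinear l -> l (a *: x) = a *: l x.
Proof. by move=> cl; have := proj2 cl a x 0; rewrite addr0 clin0// addr0. Qed.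

Lemma clinD (l : E -> F) x y : clinear l -> l (x + y) = l x + l y.
Proof. by move=> cl; have := proj2 cl 1 x y; rewrite !scale1r. Qed.

Lemma clin_comp (l : E -> F) (m : F -> G) : clinear l -> clinear m -> clinear (m \o l).
Proof.
move=> [cl ll] [cm lm]; split; last by move=> a x y /=; rewrite ll lm.
by move=> x; apply: continuous_comp; [exact: cl|exact: cm].
Qed.

Lemma clin_id : clinear (@id E).
Proof. by split => // x; exact: cvg_id. Qed.

Lemma clin_fst : clinear (@fst E F).
Proof. by split => // x; exact: cvg_fst. Qed.

Lemma clin_snd : clinear (@snd E F).
Proof. by split => // x; exact: cvg_snd. Qed.

Lemma clin_inl : clinear (fun x : E => (x, 0 : F)).
Proof.
split; first by move=> x; apply: cvg_pair_nbhs; [exact: cvg_id|exact: cvg_cst].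
by move=> a x y; rewrite [RHS]surjective_pairing /= scaler0 addr0.
Qed.

Lemma is_dir_deriv_clin (l : E -> F) x v : clinear l -> is_dir_deriv l x v (l v).
Proof.
move=> cl; apply: cvg_near_cst.
move: (nbhs_dnbhs_neq (0 : R)); apply: filterS => h h0.
by rewrite clinD// clinZ// addrC addKr scalerA mulVf ?scale1r.
Qed.

(** The difference quotients on both sides are the same, so no differentiability
    is involved. *)
Lemma is_dir_deriv_affE (f : F -> G) (c : F) (l : E -> F) x v m : clinear l ->
  is_dir_deriv (fun y => f (c + l y)) x v m = is_dir_deriv f (c + l x) (l v) m.
Proof.
move=> cl; rewrite /is_dir_deriv.
suff -> : (fun h : R => h^-1 *: (f (c + l (x + h *: v)) - f (c + l x))) =
  (fun h => h^-1 *: (f (c + l x + h *: l v) - f (c + l x))) by [].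
by apply/funext => h; rewrite clinD// clinZ// addrA.
Qed.

Lemma dir_deriv_affE (f : F -> G) (c : F) (l : E -> F) x v : clinear l ->
  dir_deriv (fun y => f (c + l y)) x v = dir_deriv f (c + l x) (l v).
Proof.
move=> cl; rewrite /dir_deriv; congr xget.
by apply/funext => m; rewrite is_dir_deriv_affE.
Qed.

Lemma iter_diff_affE (f : F -> G) (c : F) (l : E -> F) n x (v : 'I_n -> E) :
  clinear l ->
  iter_diff (fun y => f (c + l y)) x v = iter_diff f (c + l x) (fun i => l (v i)).
Proof.
move=> cl; elim: n x v => [//|n IH] x v /=; rewrite -dir_deriv_affE//.
by congr dir_deriv; apply/funext => y; rewrite IH.
Qed.

End ContinuousLinear.

Section ChainRule.
Context {R : realType} {E F G : tvsType R}.

(** Strict differentiability along the directions h^-1 (g (x + h v) - g x), which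
    tend to w. *)
Lemma is_dir_deriv_comp (f : E -> F) (df : E * E -> F) (U : set E)
    (g : G -> E) x v w : open U -> U (g x) ->
  (forall x v, U x -> is_dir_deriv f x v (df (x, v))) ->
  {for (g x, w), continuous df} -> is_dir_deriv g x v w ->
  is_dir_deriv (f \o g) x v (df (g x, w)).
Proof.
move=> oU Ux fd cdf gd.
have t0 : (fun h : R => h) @ (0 : R)^' --> (0 : R).
  by apply: cvg_within_filter; exact: cvg_id.
have tn : \forall h \near (0 : R)^', h != 0 by exact: nbhs_dnbhs_neq.
refine (cvg_trans _ (@strict_diff R E F f df U (g x) w R _ _ (fun=> g x) _ id
  oU Ux fd cdf (cvg_cst _) gd t0 tn)).
apply: near_eq_cvg; move: tn; apply: filterS => h h0 /=.
by rewrite scalerA divff// scale1r [g x + _]addrC subrK.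
Qed.

(** Additivity splits the increment along a v + w at the moving base point
    x + h a v, which strict differentiability allows. *)
Lemma is_dir_deriv_linear (f : E -> F) (df : E * E -> F) (U : set E) x (a : R) v w :
  hausdorff_space F -> open U -> U x ->
  (forall x v, U x -> is_dir_deriv f x v (df (x, v))) ->
  (forall v, {for (x, v), continuous df}) ->
  df (x, a *: v + w) = a *: df (x, v) + df (x, w).
Proof.
move=> hF oU Ux fd cdf.
have t0 : (fun h : R => h) @ (0 : R)^' --> (0 : R).
  by apply: cvg_within_filter; exact: cvg_id.
have tn : \forall h \near (0 : R)^', h != 0 by exact: nbhs_dnbhs_neq.
have df0 : df (x, 0) = 0.
  apply: (is_dir_deriv_unique hF (fd x 0 Ux)).
  apply: cvg_near_cst; apply: nearW => h /=.
  by rewrite scaler0 addr0 subrr scaler0.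
have dfZ : df (x, a *: v) = a *: df (x, v).
  have [->|a0] := eqVneq a 0; first by rewrite !scale0r df0.
  apply: (is_dir_deriv_unique hF (fd x _ Ux)).
  apply: cvg_ext (tvs_cvgZ (cvg_cst a)
    (cvg_comp _ _ (cvg_dnbhs_scale a0) (fd x v Ux))) => h /=.
  by rewrite scalerA invfM mulrA divff// mul1r scalerA [h * a]mulrC.
rewrite -dfZ; apply: (is_dir_deriv_unique hF (fd x _ Ux)).
apply: cvg_ext (tvs_cvgD (fd x (a *: v) Ux)
  (@strict_diff R E F f df U x w R _ _ (fun h => x + h *: (a *: v)) (fun=> w) id
    oU Ux fd (cdf w) (@cvg_line R E _ _) (cvg_cst _) t0 tn)) => h /=.
rewrite -scalerDr; congr (_ *: _).
by rewrite [LHS]addrC addrA subrK scalerDr addrA.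
Qed.

End ChainRule.

(** * Differentiability classes by tangent maps *)

Lemma openX {X Y : topologicalType} (A : set X) (B : set Y) :
  open A -> open B -> open (A `*` B).
Proof.
move=> oA oB; have -> : A `*` B = fst @^-1` A `&` snd @^-1` B by [].
apply: openI; apply: open_comp => // z _; [exact: cvg_fst|exact: cvg_snd].
Qed.

(** C^n by recursion on the tangent map: the differential, as a map on E * E, has
    to be C^(n-1). In this form d(g o f) = dg o (f o fst, df) makes closure under
    composition a plain induction, which it is not for iterated directional
    derivatives with the directions kept apart. *)
Fixpoint TCn {R : realType} (n : nat) :
    forall E F : tvsType R, set E -> (E -> F) -> Prop :=
  match n with
  | 0 => fun E F U f => forall x, U x -> {for x, continuous f}
  | m.+1 => fun E F U f => (forall x, U x -> {for x, continuous f}) /\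
      exists2 df : E * E -> F, (forall x v, U x -> is_dir_deriv f x v (df (x, v))) &
        TCn m (U `*` setT) df
  end.
Arguments TCn {R} n {E F} U f.

Section TCnBasics.
Context {R : realType}.
Implicit Types (E F G : tvsType R).

Lemma TCn_continuous n E F (U : set E) (f : E -> F) x :
  TCn n U f -> U x -> {for x, continuous f}.
Proof. by case: n => [|n] /=; [move=> H /H|case=> H _ /H]. Qed.

Lemma TCnW n E F (U : set E) (f : E -> F) : TCn n.+1 U f -> TCn n U f.
Proof.
elim: n E U f => [|n IH] E U f /= []; first by [].
by move=> cf [df fd dfn]; split => //; exists df => //; exact: IH.
Qed.

Lemma TCn_sub n E F (U V : set E) (f : E -> F) : V `<=` U -> TCn n U f -> TCn n V f.
Proof.
elim: n E U V f => [|n IH] E U V f VU /=; first by move=> H x /VU /H.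
move=> [cf [df fd dfn]]; split; first by move=> x /VU /cf.
exists df; first by move=> x v /VU; exact: fd.
by apply: IH dfn => z [/VU].
Qed.

Lemma TCn_eq n E F (U : set E) (f g : E -> F) : open U ->
  (forall x, U x -> f x = g x) -> TCn n U f -> TCn n U g.
Proof.
move=> oU fg.
have fgn x : U x -> \forall y \near x, f y = g y.
  move=> Ux; have : nbhs x U by exact: open_nbhs_nbhs.
  by apply: filterS => y; exact: fg.
have cg x : U x -> {for x, continuous f} -> {for x, continuous g}.
  move=> Ux cf; rewrite /continuous_at /prop_for /= -fg//.
  by apply: cvg_trans cf; apply: near_eq_cvg; exact: fgn.
case: n => [|n] /=; first by move=> cf x Ux; apply: cg => //; exact: cf.
move=> [cf [df fd dfn]]; split; first by move=> x Ux; apply: cg => //; exact: cf.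
by exists df => // x v Ux; apply: is_dir_deriv_near (fgn x Ux) (fd _ _ Ux).
Qed.

Lemma TCn_clin n E F (U : set E) (l : E -> F) : clinear l -> TCn n U l.
Proof.
elim: n E U l => [|n IH] E U l cl /=; first by move=> x _; exact: (proj1 cl).
split; first by move=> x _; exact: (proj1 cl).
exists (l \o snd); first by move=> x v _; exact: is_dir_deriv_clin.
by apply: IH; apply: clin_comp => //; exact: clin_snd.
Qed.

Lemma TCn_cst n E F (U : set E) (c : F) : TCn n U (fun _ : E => c).
Proof.
elim: n E U c => [|n IH] E U c /=; first by move=> x _; exact: cvg_cst.
split; first by move=> x _; exact: cvg_cst.
by exists (fun=> 0) => // x v _; exact: is_dir_deriv_cst.
Qed.

Lemma TCn_pair n E F G (U : set E) (f : E -> F) (g : E -> G) :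
  TCn n U f -> TCn n U g -> TCn n U (fun x => (f x, g x)).
Proof.
elim: n E U f g => [|n IH] E U f g /=.
  by move=> cf cg x Ux; apply: cvg_pair_nbhs; [exact: cf|exact: cg].
move=> [cf [df fd dfn]] [cg [dg gd dgn]]; split.
  by move=> x Ux; apply: cvg_pair_nbhs; [exact: cf|exact: cg].
exists (fun z => (df z, dg z)); last exact: IH.
move=> x v Ux; exact: cvg_pair_nbhs (fd x v Ux) (gd x v Ux).
Qed.

Lemma TCn_comp n E F G (U : set E) (V : set F) (f : E -> F) (g : F -> G) :
  open U -> open V -> (forall x, U x -> V (f x)) -> TCn n V g -> TCn n U f -> TCn n U (g \o f).
Proof.
elim: n E F G U V f g => [|n IH] E F G U V f g oU oV UV.
  move=> cg cf x Ux; apply: continuous_comp; [exact: cf|apply: cg; exact: UV].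
move=> gn fn; have := gn; have := fn.
move=> [cf [df fd dfn]] [cg [dg gd dgn]]; split.
  by move=> x Ux; apply: continuous_comp; [exact: cf|apply: cg; exact: UV].
exists (dg \o (fun z => (f z.1, df z))).
  move=> x v Ux /=; apply: (is_dir_deriv_comp oV (UV x Ux) gd); last exact: fd.
  by apply: (TCn_continuous dgn); split => //; exact: UV.
apply: (IH _ _ _ _ (V `*` setT)) => //.
- by apply: openX => //; exact: openT.
- by apply: openX => //; exact: openT.
- by move=> z [/= Uz _]; split => //; exact: UV.
apply: TCn_pair => //.
apply: (IH _ _ _ _ U fst f) => //; [|by move=> z []|exact: TCnW|].
  by apply: openX => //; exact: openT.
by apply: TCn_clin; exact: clin_fst.
Qed.

Lemma TCn_fst n E F G (U : set E) (f : E -> F) :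
  open U -> TCn n U f -> TCn n (U `*` [set: G]) (f \o fst).
Proof.
move=> oU fn; apply: (TCn_comp _ oU _ fn); last 1 first.
- by apply: TCn_clin; exact: clin_fst.
- by apply: openX => //; exact: openT.
- by move=> z [].
Qed.

Lemma TCn_add n E F (U : set E) (f g : E -> F) :
  TCn n U f -> TCn n U g -> TCn n U (fun x => f x + g x).
Proof.
elim: n E U f g => [|n IH] E U f g /=.
  by move=> cf cg x Ux; apply: tvs_cvgD; [exact: cf|exact: cg].
move=> [cf [df fd dfn]] [cg [dg gd dgn]]; split.
  by move=> x Ux; apply: tvs_cvgD; [exact: cf|exact: cg].
exists (fun z => df z + dg z); last exact: IH.
by move=> x v Ux; apply: is_dir_derivD; [exact: fd|exact: gd].
Qed.

Lemma TCn_sum n E F (U : set E) (I : Type) (r : seq I) (f : I -> E -> F) :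
  (forall i, TCn n U (f i)) -> TCn n U (fun x => \sum_(i <- r) f i x).
Proof.
move=> fn; elim: r => [|i r IH].
  have -> : (fun x => \sum_(i <- [::]) f i x) = fun _ : E => 0.
    by apply/funext => x; rewrite big_nil.
  exact: TCn_cst.
have -> : (fun x => \sum_(j <- i :: r) f j x) =
    (fun x => f i x + \sum_(j <- r) f j x).
  by apply/funext => x; rewrite big_cons.
exact: TCn_add.
Qed.

Lemma is_dir_derivM E F (k : E -> R^o) (f : E -> F) x v dk df :
  {for x, continuous f} -> is_dir_deriv k x v dk -> is_dir_deriv f x v df ->
  is_dir_deriv (fun y => k y *: f y) x v (dk *: f x + k x *: df).
Proof.
move=> cf kd fd.
have fxh : (fun h : R => f (x + h *: v)) @ (0 : R)^' --> f x.
  exact: cvg_comp (@cvg_line R E x v) cf.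
apply: cvg_ext (tvs_cvgD (tvs_cvgZ kd fxh) (tvs_cvgZ (cvg_cst (k x)) fd)) => h /=.
rewrite scalerA [k x * _]mulrC -scalerA -[X in _ + X]scalerA -scalerDr.
by congr (_ *: _); rewrite scalerBl scalerBr addrA subrK.
Qed.

Lemma TCn_scale n E F (U : set E) (k : E -> R^o) (f : E -> F) : open U ->
  TCn n U k -> TCn n U f -> TCn n U (fun x => k x *: f x).
Proof.
elim: n E U k f => [|n IH] E U k f oU kn fn.
  by move=> x Ux; apply: tvs_cvgZ; [exact: kn|exact: fn].
have oUT : open (U `*` [set: E]) by apply: openX => //; exact: openT.
have := kn; have := fn.
move=> [cf [df fd dfn]] [ck [dk kd dkn]]; split.
  by move=> x Ux; apply: tvs_cvgZ; [exact: ck|exact: cf].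
exists (fun z => dk z *: f z.1 + k z.1 *: df z).
  move=> x v Ux /=.
  exact: is_dir_derivM (cf x Ux) (kd x v Ux) (fd x v Ux).
apply: TCn_add; apply: IH => //.
- by apply: TCn_fst => //; exact: TCnW.
- by apply: (TCn_fst _ (f := k)) => //; exact: TCnW.
Qed.

End TCnBasics.

(** * Comparison with iterated directional derivatives *)

Lemma widen_lift n (i : 'I_n) : widen_ord (leqnSn n) i = lift ord_max i.
Proof. by apply: val_inj; rewrite /= /bump leqNgt ltn_ord. Qed.

Lemma cvg_ptws {T : Type} {I : eqType} {V : topologicalType} (F : set_system T)
    {FF : Filter F} (f : T -> I -> V) (g : I -> V) :
  (forall i, (fun x => f x i) @ F --> g i) ->
  (fun x => f x : {ptws I -> V}) @ F --> (g : {ptws I -> V}).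
Proof.
move=> fg; apply/cvg_sup => i A [B [[W oW <-] Wg] WA].
apply: filterS WA _; apply: (fg i).
exact: open_nbhs_nbhs.
Qed.

Lemma cvg_ptws_ev {I : eqType} {V : topologicalType} (g : {ptws I -> V}) (i : I) :
  (fun f : {ptws I -> V} => f i) @ g --> g i.
Proof.
exact: (@proj_continuous I (fun=> V) i g).
Qed.

Section TCnCn.
Context {R : realType}.
Implicit Types (E F X : tvsType R).

Lemma iter_diff_peel E F (f : E -> F) n x (v : 'I_n.+1 -> E) :
  iter_diff f x v =
  iter_diff (fun y => dir_deriv f y (v ord0)) x (fun i => v (lift ord0 i)).
Proof.
elim: n x v => [|n IH] x v /=; first by congr (dir_deriv _ _ (v _)); exact: val_inj.
transitivity (dir_deriv (fun y => iter_diff (fun y => dir_deriv f y (v ord0)) y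
  (fun i => v (lift ord0 (widen_ord (leqnSn n) i)))) x (v ord_max)).
  congr dir_deriv; apply/funext => y.
  rewrite -[LHS]/(@iter_diff _ _ _ f n.+1 y (fun i => v (widen_ord (leqnSn n.+1) i))).
  rewrite IH; have -> : widen_ord (leqnSn n.+1) ord0 = ord0 by exact: val_inj.
  have -> : (fun i : 'I_n => v (widen_ord (leqnSn n.+1) (lift ord0 i))) =
    (fun i => v (lift ord0 (widen_ord (leqnSn n) i))).
    by apply/funext => i; congr v; exact: val_inj.
  reflexivity.
by congr (dir_deriv _ _ (v _)); exact: val_inj.
Qed.

Definition tangent E F (f : E -> F) (z : E * E) : F := dir_deriv f z.1 z.2.

(** Taking off the first direction instead of the last makes a derivative of order
    n + 1 of f one of order n of its tangent map, along directions whose second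
    component vanishes. *)
Lemma iter_diff_peelE E F (f : E -> F) n x (v : 'I_n.+1 -> E) :
  iter_diff f x v =
  iter_diff (tangent f) (x, v ord0) (fun i => (v (lift ord0 i), 0 : E)).
Proof.
rewrite iter_diff_peel.
have := @iter_diff_affE R E (E * E)%type F (tangent f) (0, v ord0) (fun y => (y, 0))
  n x (fun i => v (lift ord0 i)) (@clin_inl R E E).
have e y : (0 : E, v ord0) + (y, 0 : E) = (y, v ord0).
  by rewrite [LHS]surjective_pairing /= add0r addr0.
rewrite e => <-.
have -> // : (fun y => tangent f ((0, v ord0) + (y, 0))) =
  (fun y => dir_deriv f y (v ord0)).
by apply/funext => y; rewrite e.
Qed.

Lemma TCn_Cn n E F (U : set E) (f : E -> F) : hausdorff_space F -> open U ->
  TCn n U f -> Cn n U f.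
Proof.
move=> hF; elim: n E U f => [|n IH] E U f oU fn.
  split=> // -[|//] x v _ Ux /=.
  by apply: (@continuous_comp _ _ _ fst f); [exact: cvg_fst|exact: fn].
have [cf [df fd dfn]] := fn.
have oUT : open (U `*` [set: E]) by apply: openX => //; exact: openT.
have dfE z : (U `*` setT) z -> df z = tangent f z.
  by case: z => x v [/= Ux _]; rewrite /tangent (dir_derivE hF (fd x v Ux)).
have [Cd Cc] : Cn n (U `*` setT) (tangent f).
  by apply: IH => //; exact: TCn_eq dfE dfn.
split.
  move=> [|k] x v kn Ux; first by exists (df (x, v ord_max)); exact: fd.
  have [//|l ld] := Cd k (x, v ord0) (fun i => (v (lift ord0 i), 0)) kn.
  exists l; move: ld.
  have e y : (0 : E, v ord0) + (y, 0 : E) = (y, v ord0).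
    by rewrite [LHS]surjective_pairing /= add0r addr0.
  rewrite -[X in is_dir_deriv _ X _ _]e -(is_dir_deriv_affE _ _ _ _ _ (@clin_inl R E E)).
  have -> : lift ord0 (@ord_max k) = ord_max by exact: val_inj.
  congr (is_dir_deriv _ _ _ _); apply/funext => y; rewrite e iter_diff_peelE.
  have <- : ord0 = widen_ord (leqnSn k.+1) ord0 by exact: val_inj.
  have -> : (fun i : 'I_k => (v (lift ord0 (widen_ord (leqnSn k) i)), 0 : E)) =
    (fun i => (v (widen_ord (leqnSn k.+1) (lift ord0 i)), 0)).
    by apply/funext => i; congr (v _, _); exact: val_inj.
  reflexivity.
move=> [|k] x v kn Ux.
  by apply: (@continuous_comp _ _ _ fst f); [exact: cvg_fst|exact: cf].
have -> : (fun z : E * {ptws 'I_k.+1 -> E} => iter_diff f z.1 z.2) =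
    (fun z : (E * E) * {ptws 'I_k -> (E * E)%type} => iter_diff (tangent f) z.1 z.2) \o
    (fun z : E * {ptws 'I_k.+1 -> E} =>
      ((z.1, z.2 ord0), (fun i => (z.2 (lift ord0 i), 0)) : {ptws 'I_k -> (E * E)%type})).
  by apply/funext => z /=; rewrite -iter_diff_peelE.
have cev i : (fun z : E * {ptws 'I_k.+1 -> E} => z.2 i) @ (x, v) --> v i.
  apply: (@cvg_comp _ _ _ snd (fun g : {ptws _ -> _} => g i)); first exact: cvg_snd.
  exact: cvg_ptws_ev.
apply: continuous_comp; last exact: Cc.
apply: cvg_pair_nbhs; first by apply: cvg_pair_nbhs; [exact: cvg_fst|exact: cev].
apply: cvg_ptws => i; apply: cvg_pair_nbhs; first exact: cev.
exact: cvg_cst.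
Qed.

Definition set_slot m E (v : 'I_m -> E) i (u : E) : 'I_m -> E :=
  fun j => if j == i then u else v j.

Definition snoc m E (v : 'I_m -> E) (u : E) : 'I_m.+1 -> E :=
  fun j => if unlift ord_max j is Some i then v i else u.

Lemma snoc_widen m E (v : 'I_m -> E) u :
  (fun i => snoc v u (widen_ord (leqnSn m) i)) = v.
Proof. by apply/funext => i; rewrite widen_lift /snoc liftK. Qed.

Lemma snoc_max m E (v : 'I_m -> E) u : snoc v u ord_max = u.
Proof. by rewrite /snoc unlift_none. Qed.

Section CnMultilinear.
Variables (E F : tvsType R) (N : nat) (U : set E) (f : E -> F).
Hypotheses (hF : hausdorff_space F) (oU : open U) (fC : Cn N U f).

Lemma Cn_derivE m x (v : 'I_m.+1 -> E) : (m < N)%N -> U x ->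
  is_dir_deriv (fun y => iter_diff f y (fun i => v (widen_ord (leqnSn m) i)))
    x (v ord_max) (iter_diff f x v).
Proof.
move=> mN Ux; have [l ld] := proj1 fC m x v mN Ux.
by rewrite /= (dir_derivE hF ld).
Qed.

(** The last slot is linear as a differential. The other slots stay linear
    because a limit of difference quotients of linear maps is linear. *)
Lemma iter_diff_multilinear m x (v : 'I_m -> E) i (a : R) u w :
  (m <= N)%N -> U x ->
  iter_diff f x (set_slot v i (a *: u + w)) =
  a *: iter_diff f x (set_slot v i u) + iter_diff f x (set_slot v i w).
Proof.
elim: m x v i => [|m IH] x v i; first by case: i.
move=> mN Ux.
have [j ij|ii] := unliftP ord_max i.
  have e u' : (fun k => set_slot v i u' (widen_ord (leqnSn m) k)) =
      set_slot (fun k => v (widen_ord (leqnSn m) k)) j u'.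
    by apply/funext => k; rewrite /set_slot ij !widen_lift (inj_eq lift_inj).
  have e2 u' : set_slot v i u' ord_max = v ord_max.
    by rewrite /set_slot ij (negbTE (neq_lift _ _)).
  have dd u' : is_dir_deriv (fun y => iter_diff f y
      (set_slot (fun k => v (widen_ord (leqnSn m) k)) j u')) x (v ord_max)
      (iter_diff f x (set_slot v i u')).
    by have := @Cn_derivE _ _ (set_slot v i u') mN Ux; rewrite e e2.
  apply: (is_dir_deriv_unique hF (dd _)).
  have := is_dir_derivD (@is_dir_derivZ R E F _ _ _ _ a (dd u)) (dd w).
  apply: is_dir_deriv_near.
  have : nbhs x U by exact: open_nbhs_nbhs.
  by apply: filterS => y Uy; rewrite IH// ltnW.
pose g y := iter_diff f y (fun k => v (widen_ord (leqnSn m) k)).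
have e u' : (fun k => set_slot v i u' (widen_ord (leqnSn m) k)) =
    (fun k => v (widen_ord (leqnSn m) k)).
  by apply/funext => k; rewrite /set_slot ii widen_lift eq_sym (negbTE (neq_lift _ _)).
have gd y u' : U y -> is_dir_deriv g y u' (iter_diff f y (set_slot v i u')).
  move=> Uy; have := @Cn_derivE _ _ (set_slot v i u') mN Uy.
  have e3 : set_slot v i u' ord_max = u' by rewrite /set_slot ii eqxx.
  by rewrite e e3.
apply: (@is_dir_deriv_linear R E F g (fun z => iter_diff f z.1 (set_slot v i z.2)) U
  x a u w hF oU Ux) => // u'.
apply: (@continuous_comp _ _ _ (fun z : E * E => (z.1, set_slot v i z.2 : {ptws _ -> _}))
  (fun z : E * {ptws 'I_m.+1 -> E} => iter_diff f z.1 z.2)).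
  apply: cvg_pair_nbhs; first exact: cvg_fst.
  apply: cvg_ptws => j; rewrite /set_slot; case: ifP => _; first exact: cvg_snd.
  exact: cvg_cst.
exact: (proj2 fC).
Qed.

(** Arguments of the i-th term when b is changed to b + h c one slot after the
    other. *)
Definition mixed m (b c : 'I_m -> E) (h : R) (i : 'I_m) : 'I_m -> E :=
  fun j => if (j < i)%N then b j + h *: c j else if j == i then c i else b j.

Lemma iter_diff_telescope m x (b c : 'I_m -> E) (h : R) : (m <= N)%N -> U x ->
  iter_diff f x (fun j => b j + h *: c j) =
  iter_diff f x b + \sum_(i < m) h *: iter_diff f x (mixed b c h i).
Proof.
move=> mN Ux.
pose args p := fun j : 'I_m => if (j < p)%N then b j + h *: c j else b j.
pose u p := iter_diff f x (args p).
have -> : iter_diff f x (fun j => b j + h *: c j) = u m.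
  by congr iter_diff; apply/funext => j; rewrite /args ltn_ord.
have -> : iter_diff f x b = u 0 by congr iter_diff; apply/funext => j.
apply/eqP; rewrite addrC -subr_eq -(telescope_sumr _ (leq0n m)) big_mkord; apply/eqP.
apply: eq_bigr => i _.
have a1 : args i.+1 = set_slot (args i) i (h *: c i + b i).
  apply/funext => j; rewrite /args /set_slot ltnS leq_eqVlt -val_eqE /=.
  by case: eqP => [/val_inj ->|//] /=; rewrite addrC.
have a2 : set_slot (args i) i (b i) = args i.
  by apply/funext => j; rewrite /set_slot /args; case: eqP => [->|//]; rewrite ltnn.
have a3 : set_slot (args i) i (c i) = mixed b c h i.
  apply/funext => j; rewrite /set_slot /args /mixed.
  by case: eqP => [->|//]; rewrite ltnn.
by rewrite /u a1 iter_diff_multilinear// a2 a3 addrK.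
Qed.

(** Maps z |-> d^m f(g z).(a_1 z, ..., a_m z) with g and the a_i continuous linear
    are closed under tangent maps: the differential in the direction w either
    appends g w to the directions or replaces some a_i z by a_i w. For m = 0 and
    g = id this bounds the class of f itself. *)
Lemma TCn_iter_diff k X m (g : X -> E) (a : 'I_m -> X -> E) :
  (m + k <= N)%N -> clinear g -> (forall i, clinear (a i)) ->
  TCn k (g @^-1` U) (fun z => iter_diff f (g z) (fun i => a i z)).
Proof.
have cont X' m' (g' : X' -> E) (a' : 'I_m' -> X' -> E) : (m' <= N)%N ->
    clinear g' -> (forall i, clinear (a' i)) -> forall z, U (g' z) ->
    {for z, continuous (fun z => iter_diff f (g' z) (fun i => a' i z))}.
  move=> mN cg ca z Uz.
  apply: (@continuous_comp _ _ _
    (fun z : X' => (g' z, (fun i => a' i z) : {ptws 'I_m' -> E}))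
    (fun z : E * {ptws 'I_m' -> E} => iter_diff f z.1 z.2)).
    apply: cvg_pair_nbhs; first exact: (proj1 cg).
    by apply: cvg_ptws => i; exact: (proj1 (ca i)).
  exact: (proj2 fC).
elim: k X m g a => [|k IH] X m g a mk cg ca.
  by move=> z Uz; apply: cont => //; rewrite -(addn0 m).
have mN : (m < N)%N by apply: leq_trans mk; rewrite addnS ltnS leq_addr.
split; first by move=> z Uz; apply: cont => //; exact: ltnW.
pose a1 (j : 'I_m.+1) : X * X -> E :=
  if unlift ord_max j is Some i then a i \o fst else g \o snd.
pose a2 (i j : 'I_m) : X * X -> E := if j == i then a j \o snd else a j \o fst.
exists (fun z => iter_diff f (g z.1) (fun j => a1 j z) +
   \sum_(i < m) iter_diff f (g z.1) (fun j => a2 i j z)); last first.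
  have -> : g @^-1` U `*` setT = (g \o fst : X * X -> E) @^-1` U.
    by apply/seteqP; split => [z []|z Uz] //.
  have cf (l : X -> E) : clinear l -> clinear (l \o fst : X * X -> E).
    by move=> cl; apply: clin_comp => //; exact: clin_fst.
  have cs (l : X -> E) : clinear l -> clinear (l \o snd : X * X -> E).
    by move=> cl; apply: clin_comp => //; exact: clin_snd.
  apply: TCn_add.
    apply: (IH _ m.+1 (g \o fst) a1); rewrite ?addSnnS//; first exact: cf.
    by move=> j; rewrite /a1; case: unlift => [i|]; [exact: cf|exact: cs].
  apply: TCn_sum => i; apply: (IH _ m (g \o fst) (a2 i)).
  - by apply: leq_trans mk; rewrite leq_add2l.
  - exact: cf.
  - by move=> j; rewrite /a2; case: eqP => _; [exact: cs|exact: cf].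
move=> z w /= Uz.
pose b i := a i z; pose c i := a i w.
have d1 : is_dir_deriv (fun y => iter_diff f y b) (g z) (g w)
    (iter_diff f (g z) (fun j => a1 j (z, w))).
  have -> : (fun j => a1 j (z, w)) = snoc b (g w).
    by apply/funext => j; rewrite /a1 /snoc; case: unlift.
  have := @Cn_derivE _ _ (snoc b (g w)) mN Uz.
  by rewrite snoc_widen snoc_max.
have lineU : (fun h : R => g z + h *: g w) @ (0 : R)^' --> g z by exact: cvg_line.
have d2 i : (fun h : R => iter_diff f (g z + h *: g w) (mixed b c h i)) @ (0 : R)^'
    --> iter_diff f (g z) (fun j => a2 i j (z, w)).
  have cD := proj2 fC m (g z) (fun j => a2 i j (z, w)) (ltnW mN) Uz.
  apply: (@cvg_comp _ _ _
    (fun h : R => (g z + h *: g w, mixed b c h i : {ptws 'I_m -> E}))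
    (fun z : E * {ptws 'I_m -> E} => iter_diff f z.1 z.2) _ _ _ _ cD).
  apply: cvg_pair_nbhs; first exact: lineU.
  apply: cvg_ptws => j; rewrite /mixed /a2.
  have [->|_] := eqVneq j i; first by rewrite ltnn; exact: cvg_cst.
  case: (j < i)%N; last exact: cvg_cst.
  exact: (@cvg_line R E (b j) (c j)).
have d3 : (fun h : R => \sum_(i < m) iter_diff f (g z + h *: g w) (mixed b c h i))
    @ (0 : R)^' --> \sum_(i < m) iter_diff f (g z) (fun j => a2 i j (z, w)).
  elim: (index_enum _) => [|i r IHr].
    rewrite big_nil; apply: cvg_near_cst; apply: nearW => h; exact: big_nil.
  rewrite big_cons; apply: cvg_ext (tvs_cvgD (d2 i) IHr) => h.
  by rewrite big_cons.
refine (cvg_trans _ (tvs_cvgD d1 d3)); apply: near_eq_cvg.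
have hU : \forall h \near (0 : R)^', U (g z + h *: g w).
  by apply: lineU; exact: open_nbhs_nbhs.
move: (nbhs_dnbhs_neq (0 : R)) hU; apply: filterS2 => h h0 Uh.
rewrite (clinD _ _ cg) (clinZ _ _ cg).
have -> : (fun i => a i (z + h *: w)) = (fun i => b i + h *: c i).
  by apply/funext => i; rewrite (clinD _ _ (ca i)) (clinZ _ _ (ca i)).
rewrite iter_diff_telescope// ?(ltnW mN)//.
by rewrite -scaler_sumr addrAC [RHS]scalerDr scalerA mulVf// scale1r.
Qed.

Lemma Cn_TCn : TCn N U f.
Proof.
by have := @TCn_iter_diff N E 0 id (fun _ _ => 0) (leqnn _) (@clin_id R E); apply; case.
Qed.

End CnMultilinear.
End TCnCn.

(** * Smooth bump functions *)

Section RealFunctions.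
Context {R : realType}.

Lemma is_dir_deriv_real (F : tvsType R) (f : R^o -> F) (x v : R) (l : F) :
  is_dir_deriv f x 1 l -> is_dir_deriv f x v (v *: l).
Proof.
move=> fl; have [->|v0] := eqVneq v 0.
  rewrite scale0r; apply: cvg_near_cst; apply: nearW => h.
  by rewrite scaler0 addr0 subrr scaler0.
apply: cvg_ext (tvs_cvgZ (cvg_cst v) (cvg_comp _ _ (cvg_dnbhs_scale v0) fl)) => h /=.
rewrite scalerA invfM mulrA divff// mul1r; congr (_ *: (f (x + _) - _)).
by rewrite /GRing.scale /= mulr1 mulrC.
Qed.

Lemma is_dir_deriv_expR (x v : R^o) :
  is_dir_deriv (expR : R^o -> R^o) x v (expR x * v).
Proof.
rewrite mulrC; apply: is_dir_deriv_real.
have [ed <-] := is_derive_expR x; rewrite /is_dir_deriv.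
apply: cvg_ext ed => h /=.
by rewrite [h *: _ + x]addrC.
Qed.

Lemma open_neq0 : open [set x : R^o | x != 0].
Proof.
rewrite openE => x /= x0; exists `|x|; first by rewrite /= normr_gt0.
move=> y /=; apply: contraTneq => ->.
by rewrite subr0 ltxx.
Qed.

Lemma continuous_inv (x : R) : x != 0 -> {for x, continuous (fun y : R^o => y^-1 : R^o)}.
Proof. by move=> x0; apply: cvgV => //; exact: cvg_id. Qed.

Lemma is_dir_deriv_inv (x v : R^o) : x != 0 ->
  is_dir_deriv (fun y : R^o => y^-1 : R^o) x v ((x^-1 * x^-1) *: (- v)).
Proof.
move=> x0; have -> : (x^-1 * x^-1) *: (- v) = v *: (- (x^-1 * x^-1)) :> R^o.
  by rewrite /GRing.scale /= mulrN mulrN mulrC.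
apply: is_dir_deriv_real.
have cx0 : (fun h : R => (x + h *: (1 : R^o))^-1 : R^o) @ (0 : R)^' --> (x^-1 : R^o).
  exact: cvg_comp (@cvg_line R R^o x 1) (continuous_inv x0).
refine (cvg_trans _ (tvs_cvgN (V := R^o)
  (tvs_cvgZ (V := R^o) cx0 (cvg_cst (x^-1 : R^o))))); apply: near_eq_cvg.
have nz : \forall h \near (0 : R)^', x + h *: (1 : R^o) != 0.
  apply: (@cvg_line R R^o x 1 [set y | y != 0]).
  by apply: open_nbhs_nbhs; split => //; exact: open_neq0.
move: (nbhs_dnbhs_neq (0 : R)) nz; apply: filterS2 => h h0 xh0.
rewrite /GRing.scale /= in xh0 *; rewrite mulr1 in xh0 *.
by field; apply/and3P.
Qed.

Lemma continuous_invX m (x : R) : x != 0 ->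
  {for x, continuous (fun y : R^o => y^-1 ^+ m : R^o)}.
Proof.
move=> x0; elim: m => [|m IH]; first exact: cvg_cst.
have -> : (fun y : R^o => y^-1 ^+ m.+1 : R^o) = (fun y => y^-1 *: (y^-1 ^+ m : R^o)).
  by apply/funext => y; rewrite exprS.
exact: (tvs_cvgZ (V := R^o) (continuous_inv x0) IH).
Qed.

Lemma TCn_inv n : TCn n [set x : R^o | x != 0] (fun y : R^o => y^-1 : R^o).
Proof.
have cV x : x != 0 -> {for x, continuous (fun y : R^o => y^-1 : R^o)}.
  exact: continuous_inv.
have oV : open [set x : R^o | x != 0].
  exact: open_neq0.
elim: n => [|n IH] /=; first by move=> x x0; exact: cV.
split; first by move=> x x0; exact: cV.
exists (fun z => (z.1^-1 * z.1^-1) *: (- z.2)).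
  by move=> x v x0; exact: is_dir_deriv_inv.
have oVT : open ([set x : R^o | x != 0] `*` [set: R^o]).
  by apply: openX => //; exact: openT.
apply: (TCn_scale (k := fun z : R^o * R^o => z.1^-1 * z.1^-1)) => //.
  by apply: (TCn_scale (F := R^o)) => //; exact: TCn_fst IH.
apply: TCn_clin; split; last first.
  by move=> a x y /=; rewrite opprD scalerN.
by move=> z; exact: (tvs_cvgN (V := R^o) cvg_snd).
Qed.

(** The factor t^-m is there because only the whole family, with all m, is closed
    under differentiation. *)
Definition flat (m : nat) (t : R^o) : R^o :=
  if 0 < t then expR (- t^-1) * t^-1 ^+ m else 0.

Lemma flat_ge0 m t : 0 <= flat m t.
Proof.
rewrite /flat; case: ifP => // t0.
by rewrite mulr_ge0 ?expR_ge0// exprn_ge0// invr_ge0 ltW.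
Qed.

(** Comparison of exp(1/t) with one term of its series. Continuity at 0 follows for
    every m, and then differentiability there, since flat m h / h = flat m.+1 h. *)
Lemma flat_le m t : flat m t <= (m.+1)`!%:R * `|t|.
Proof.
rewrite /flat; case: ifP => t0; last by rewrite mulr_ge0.
rewrite (gtr0_norm t0) expRN mulrC ler_pdivrMr ?expR_gt0//.
have := @expR_ge1Dxn R t^-1 m; rewrite invr_ge0 (ltW t0) => /(_ isT) H.
have f0 : 0 < (m.+1)`!%:R :> R by rewrite ltr0n fact_gt0.
have : t^-1 ^+ m.+1 / (m.+1)`!%:R <= expR t^-1 by apply: le_trans H; rewrite lerDr.
rewrite ler_pdivrMr// exprS => H2.
have -> : t^-1 ^+ m = t * (t^-1 * t^-1 ^+ m) by rewrite mulrA mulfV ?mul1r// gt_eqF.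
have -> : (m.+1)`!%:R * t * expR t^-1 = t * (expR t^-1 * (m.+1)`!%:R) :> R by ring.
by rewrite ler_pM2l.
Qed.

Lemma flat_cvg0 m : (fun t => flat m t) @ (0 : R^o) --> (0 : R^o).
Proof.
apply: (@squeeze_cvgr _ _ _ _ (fun=> 0) (fun t : R^o => (m.+1)`!%:R * `|t|)).
- by apply: nearW => t; rewrite flat_ge0 flat_le.
- exact: cvg_cst.
- have := @norm_continuous R R^o 0; rewrite /continuous_at normr0 => cn.
  rewrite -[X in _ --> X](mulr0 ((m.+1)`!%:R : R)).
  exact: (tvs_cvgZ (V := R^o) (cvg_cst ((m.+1)`!%:R : R)) cn).
Qed.

Lemma flat0 m : flat m 0 = 0. Proof. by rewrite /flat ltxx. Qed.

Lemma is_dir_deriv_invX m (x v : R^o) : x != 0 ->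
  is_dir_deriv (fun y : R^o => y^-1 ^+ m : R^o) x v
    (- (m%:R * x^-1 ^+ m.+1) * v).
Proof.
move=> x0; elim: m => [|m IH].
  rewrite mul0r oppr0 mul0r; exact: is_dir_deriv_cst.
have := is_dir_derivM _ (@is_dir_deriv_inv x v x0) IH.
move=> /(_ (@continuous_invX m x x0)); set L := (X in is_dir_deriv _ _ _ X -> _).
have -> : L = (- (m.+1%:R * x^-1 ^+ m.+2) * v : R^o).
  rewrite /L /GRing.scale /= !exprS -[m.+1%:R]natr1.
  by ring.
by apply: is_dir_deriv_ext => y; rewrite exprS.
Qed.

Lemma is_dir_deriv_flat m (x v : R^o) :
  is_dir_deriv (flat m) x v ((flat m.+2 x + (- m%:R) *: flat m.+1 x) *: v).
Proof.
have [x0|x0|<-] := ltgtP 0 x.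
- have xn : x != 0 by rewrite gt_eqF.
  have d1 : is_dir_deriv (fun y : R^o => expR (- y^-1) : R^o) x v
      (expR (- x^-1) * (x^-1 * x^-1 * v)).
    apply: (@is_dir_deriv_comp R R^o R^o R^o expR (fun z => expR z.1 * z.2) setT
      (fun y => - y^-1)) => //; first exact: openT.
    + by move=> y w _; exact: is_dir_deriv_expR.
    + apply: (@tvs_cvgZ R R^o); last exact: cvg_snd.
      by apply: cvg_comp; [exact: cvg_fst|exact: continuous_expR].
    + have := @is_dir_derivZ R R^o R^o _ _ _ _ (-1) (@is_dir_deriv_inv x v xn).
      have -> : -1 *: ((x^-1 * x^-1) *: - v) = x^-1 * x^-1 * v :> R^o.
        by rewrite scaleN1r scalerN opprK.
      by apply: is_dir_deriv_ext => y; rewrite scaleN1r.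
  have := is_dir_derivM (@continuous_invX m x xn) d1 (@is_dir_deriv_invX m x v xn).
  set L := (X in is_dir_deriv _ _ _ X -> _).
  have -> : L = (flat m.+2 x + - m%:R *: flat m.+1 x) *: v.
    by rewrite /L /flat x0 /GRing.scale /= !exprS; ring.
  apply: is_dir_deriv_near.
  have : nbhs x [set y | 0 < y] by apply: open_nbhs_nbhs; split => //; exact: open_gt.
  by apply: filterS => y /= y0; rewrite /flat y0.
- have -> : (flat m.+2 x + - m%:R *: flat m.+1 x) *: v = 0.
    by rewrite /flat ltNge (ltW x0)/= scaler0 addr0 scale0r.
  apply: is_dir_deriv_near (@is_dir_deriv_cst R R^o R^o 0 x v).
  have : nbhs x [set y | y < 0] by apply: open_nbhs_nbhs; split => //; exact: open_lt.
  by apply: filterS => y /= y0; rewrite /flat ltNge (ltW y0).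
- rewrite !flat0 scaler0 addr0 scale0r.
  suff H : is_dir_deriv (flat m) (0 : R^o) (1 : R^o) (0 : R^o).
    by have := @is_dir_deriv_real _ _ 0 v 0 H; rewrite scaler0.
  have c0 : (fun t => flat m.+1 t) @ (0 : R)^' --> (0 : R^o).
    by apply: cvg_within_filter; exact: flat_cvg0.
  refine (cvg_trans _ c0); apply: near_eq_cvg.
  move: (nbhs_dnbhs_neq (0 : R)); apply: filterS => h h0.
  rewrite add0r flat0 subr0 /flat /GRing.scale /= mulr1.
  by case: ifP => // _; rewrite ?mulr0// mulrCA exprS.
Qed.

Lemma continuous_flat m x : {for x, continuous (flat m)}.
Proof.
have [x0|x0|<-] := ltgtP 0 x; last by rewrite /prop_for /continuous_at flat0; exact: flat_cvg0.
- have xn : x != 0 by rewrite gt_eqF.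
  have cX : {for x, continuous (fun y : R^o => expR (- y^-1) * y^-1 ^+ m : R^o)}.
    apply: (@tvs_cvgZ R R^o).
      apply: (@cvg_comp _ _ _ (fun y : R^o => - y^-1 : R^o) expR); last exact: continuous_expR.
      exact: (tvs_cvgN (V := R^o) (continuous_inv xn)).
    exact: continuous_invX.
  rewrite /prop_for /continuous_at {2}/flat x0.
  refine (cvg_trans _ cX); apply: near_eq_cvg.
  have : nbhs x [set y | 0 < y] by apply: open_nbhs_nbhs; split => //; exact: open_gt.
  by apply: filterS => y /= y0; rewrite /flat y0.
- rewrite /prop_for /continuous_at {2}/flat ltNge (ltW x0)/=.
  apply: cvg_near_cst.
  have : nbhs x [set y | y < 0] by apply: open_nbhs_nbhs; split => //; exact: open_lt.
  by apply: filterS => y /= y0; rewrite /flat ltNge (ltW y0).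
Qed.

Lemma TCn_flat n m : TCn n setT (flat m).
Proof.
elim: n m => [|n IH] m /=; first by move=> x _; exact: continuous_flat.
split; first by move=> x _; exact: continuous_flat.
exists (fun z => (flat m.+2 z.1 + - m%:R *: flat m.+1 z.1) *: z.2).
  by move=> x v _; exact: is_dir_deriv_flat.
have oT : open ([set: R^o] `*` [set: R^o]) by apply: openX; exact: openT.
have Hf k : TCn n ([set: R^o] `*` [set: R^o]) (fun z : R^o * R^o => flat k z.1).
  exact: (@TCn_fst R n R^o R^o R^o setT (flat k) openT (IH k)).
apply: (TCn_scale (k := fun z : R^o * R^o => flat m.+2 z.1 + - m%:R *: flat m.+1 z.1)) => //.
  apply: TCn_add => //.
  by apply: (TCn_scale (k := fun _ => - m%:R)) => //; exact: TCn_cst.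
by apply: TCn_clin; exact: clin_snd.
Qed.

Definition smooth_step (t : R^o) : R^o := (flat 0 t + flat 0 (1 - t))^-1 * flat 0 t.

Lemma flat_gt0 m t : 0 < t -> 0 < flat m t.
Proof. by move=> t0; rewrite /flat t0 mulr_gt0 ?expR_gt0// exprn_gt0// invr_gt0. Qed.

Lemma step_den t : 0 < flat 0 t + flat 0 (1 - t).
Proof.
have [t0|t0] := ltP 0 t.
  by rewrite ltr_wpDr ?flat_gt0// flat_ge0.
by rewrite ltr_wpDl ?flat_ge0// flat_gt0//; lra.
Qed.

Lemma step_ge0 t : 0 <= smooth_step t.
Proof. by rewrite mulr_ge0 ?flat_ge0// invr_ge0 ltW// step_den. Qed.

Lemma step_le1 t : smooth_step t <= 1.
Proof. by rewrite /smooth_step mulrC ler_pdivrMr ?step_den// mul1r lerDl flat_ge0. Qed.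

Lemma step1 t : 1 <= t -> smooth_step t = 1.
Proof.
move=> t1; rewrite /smooth_step [X in _ + X](_ : _ = 0).
  by rewrite addr0 mulVf// gt_eqF// flat_gt0// (lt_le_trans ltr01).
by rewrite /flat ifF//; apply/negbTE; rewrite -leNgt; lra.
Qed.

Lemma step_neq0 t : smooth_step t != 0 -> 0 < t.
Proof.
rewrite ltNge; apply: contra_neqN => t0.
have f0 : flat 0 t = 0 by rewrite /flat ltNge t0.
by rewrite /smooth_step f0 mulr0.
Qed.

Lemma TCn_step n : TCn n setT smooth_step.
Proof.
have aff : TCn n [set: R^o] (fun t : R^o => flat 0 (1 - t)).
  apply: (@TCn_comp R n R^o R^o R^o setT setT (fun t => 1 - t) (flat 0)) => //.
  - exact: openT.
  - exact: openT.
  - exact: TCn_flat.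
  apply: TCn_add; first exact: TCn_cst.
  apply: TCn_clin; split; first by move=> x; exact: (tvs_cvgN (V := R^o) cvg_id).
  by move=> a x y; rewrite opprD scalerN.
apply: (TCn_scale (F := R^o) (k := fun t => (flat 0 t + flat 0 (1 - t))^-1)).
- exact: openT.
- apply: (TCn_comp _ _ _ (TCn_inv n)) => //; first exact: openT.
  + by move=> x _ /=; rewrite gt_eqF// step_den.
  + by apply: TCn_add => //; exact: TCn_flat.
- exact: TCn_flat.
Qed.

Lemma TCn_prod n (E : tvsType R) (U : set E) (I : Type) (r : seq I) (f : I -> E -> R^o) :
  open U -> (forall i, TCn n U (f i)) -> TCn n U (fun x => \prod_(i <- r) f i x : R^o).
Proof.
move=> oU fn; elim: r => [|i r IH].
  have -> : (fun x => \prod_(i <- [::]) f i x) = fun _ : E => 1 : R^o.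
    by apply/funext => x; rewrite big_nil.
  exact: TCn_cst.
have -> : (fun x => \prod_(j <- i :: r) f j x) =
    (fun x => f i x *: (\prod_(j <- r) f j x : R^o)).
  by apply/funext => x; rewrite big_cons.
exact: TCn_scale.
Qed.

Lemma bump_rV d (a : 'rV[R]_d) (r : R) : 0 < r -> exists b : 'rV[R]_d -> R^o,
  [/\ forall n, TCn n setT b, (forall y : 'rV[R]_d, 0 <= b y /\ b y <= 1),
      (forall y : 'rV[R]_d, (forall i, `|y ord0 i - a ord0 i| <= r) -> b y = 1) &
      (forall y : 'rV[R]_d, b y != 0 -> forall i, `|y ord0 i - a ord0 i| < 2 * r)].
Proof.
move=> r0.
pose u i (y : 'rV[R]_d) : R^o := (y ord0 i - a ord0 i) / r.
exists (fun y => \prod_(i < d) (smooth_step (2 - u i y) * smooth_step (2 + u i y))); split.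
- move=> n; apply: TCn_prod; first exact: openT.
  have cl i : clinear (fun y : 'rV[R]_d => r^-1 *: (y ord0 i : R^o)).
    split; last by move=> k x y /=; rewrite !mxE scalerDr; congr (_ + _); exact: mulrCA.
    move=> y.
    have cy : (fun y : 'rV[R]_d => y ord0 i : R^o) @ y --> (y ord0 i : R^o).
      exact: coord_continuous.
    exact: (tvs_cvgZ (cvg_cst (r^-1)) cy).
  have su i : TCn n [set: 'rV[R]_d] (u i).
    have -> : u i = fun y => r^-1 *: (y ord0 i : R^o) + (- (a ord0 i) / r).
      by apply/funext => y; rewrite /u mulrBl mulrC mulNr.
    by apply: TCn_add; [apply: TCn_clin; exact: cl|exact: TCn_cst].
  have sstep (g : 'rV[R]_d -> R^o) : TCn n setT g -> TCn n setT (smooth_step \o g).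
    by move=> gn; apply: (TCn_comp _ _ _ (TCn_step n) gn) => //; exact: openT.
  move=> i; apply: (TCn_scale (F := R^o) (k := smooth_step \o (fun y => 2 - u i y))).
  + exact: openT.
  + apply: sstep; apply: TCn_add; first exact: TCn_cst.
    have -> : (fun x => - u i x) = (fun x => (-1) *: u i x).
      by apply/funext => x; rewrite scaleN1r.
    by apply: (TCn_scale (k := fun _ => -1)) => //; [exact: openT|exact: TCn_cst].
  + apply: (sstep (fun y => 2 + u i y)).
    by apply: TCn_add => //; exact: TCn_cst.
- move=> y; split; first by apply: prodr_ge0 => i _; rewrite mulr_ge0 ?step_ge0.
  apply: prodr_ile1 => i _.
  rewrite mulr_ge0 ?step_ge0//=.
  by rewrite mulr_ile1 ?step_ge0 ?step_le1.
- move=> y yr; rewrite big1// => i _.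
  have := yr i; rewrite ler_norml => /andP[h1 h2].
  have l1 : u i y <= 1 by rewrite /u ler_pdivrMr// mul1r.
  have l2 : -1 <= u i y by rewrite /u ler_pdivlMr// mulN1r.
  by rewrite !step1 ?mul1r//; lra.
- move=> y yr i.
  have : smooth_step (2 - u i y) * smooth_step (2 + u i y) != 0.
    by apply: contraNneq yr => h; rewrite (bigD1 i)//= h mul0r.
  rewrite mulf_eq0 negb_or => /andP[/step_neq0 h1 /step_neq0 h2].
  have e : y ord0 i - a ord0 i = u i y * r by rewrite /u divfK// gt_eqF.
  rewrite e ltr_norml -mulNr !ltr_pM2r//; apply/andP; split; lra.
Qed.

End RealFunctions.

(** * Smooth maps in charts *)

Lemma hausdorff_pair {X Y : topologicalType} :
  hausdorff_space X -> hausdorff_space Y -> hausdorff_space (X * Y)%type.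
Proof.
move=> hX hY [x y] [x' y'] cl; congr (_, _).
  apply: hX => A B nA nB; have [||[a b] [/= Aa Ba]] := cl (A `*` setT) (B `*` setT).
  - by exists (A, setT) => //; split => //; exact: filterT.
  - by exists (B, setT) => //; split => //; exact: filterT.
  by exists a; split; [exact: (proj1 Aa)|exact: (proj1 Ba)].
apply: hY => A B nA nB; have [||[a b] [/= Aa Ba]] := cl (setT `*` A) (setT `*` B).
- by exists (setT, A) => //; split => //; exact: filterT.
- by exists (setT, B) => //; split => //; exact: filterT.
by exists b; split; [exact: (proj2 Aa)|exact: (proj2 Ba)].
Qed.

Lemma within_open_continuous {X Y : topologicalType} (W : set X) (f : X -> Y) x :
  open W -> W x -> {within W, continuous f} -> {for x, continuous f}.
Proof.
move=> oW Wx /subspace_continuousP /(_ x Wx) cf A nA.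
have nW : nbhs x W by exact: open_nbhs_nbhs.
have H : nbhs x (fun y => W y -> A (f y)) := cf A nA.
have : nbhs x (f @^-1` A) by apply: filterS2 H nW => y /[apply].
by [].
Qed.

Lemma nbhsW {X : topologicalType} (x : X) (P : X -> Prop) :
  (forall y, P y) -> \forall y \near x, P y.
Proof.
by move=> H; apply: (@filterS X (nbhs x) _ setT) => //; exact: filterT.
Qed.

Lemma nbhs_openS {X : topologicalType} (x : X) (A : set X) :
  nbhs x A -> exists U, [/\ open U, U x & U `<=` A].
Proof. by rewrite nbhsE => -[U [oU Ux] UA]; exists U. Qed.

Section Germs.
Context {R : realType}.
Implicit Types (E F G : tvsType R).

Definition smooth_germ E F (g : E -> F) (e : E) :=
  exists U, [/\ open U, U e & forall n, TCn n U g].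

Lemma smooth_germ_comp E F G (g : E -> F) (h : F -> G) e :
  smooth_germ g e -> smooth_germ h (g e) -> smooth_germ (h \o g) e.
Proof.
move=> [U [oU Ue gn]] [V [oV Ve hn]].
have oW : open (U `&` g @^-1` V).
  rewrite openE => x [Ux Vx]; apply: filterI; first exact: open_nbhs_nbhs.
  by apply: (TCn_continuous (gn 0) Ux); exact: open_nbhs_nbhs.
exists (U `&` g @^-1` V); split => // n; apply: (TCn_comp oW oV _ (hn n)).
  by move=> x [].
by apply: TCn_sub (gn n) => x [].
Qed.

Lemma smooth_germ2 E F G (f : E -> F) (g : E -> G) e :
  smooth_germ f e -> smooth_germ g e ->
  exists U, [/\ open U, U e & forall n, TCn n U f /\ TCn n U g].
Proof.
move=> [U [oU Ue fn]] [V [oV Ve gn]]; exists (U `&` V); split => //.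
  exact: openI.
move=> n; split; [apply: TCn_sub (fn n)|apply: TCn_sub (gn n)] => x [] //.
Qed.

Lemma smooth_germ_pair E F G (f : E -> F) (g : E -> G) e :
  smooth_germ f e -> smooth_germ g e -> smooth_germ (fun x => (f x, g x)) e.
Proof.
move=> fe ge; have [U [oU Ue fgn]] := smooth_germ2 fe ge.
by exists U; split => // n; have [] := fgn n; exact: TCn_pair.
Qed.

Lemma smooth_germ_add E F (f g : E -> F) e :
  smooth_germ f e -> smooth_germ g e -> smooth_germ (fun x => f x + g x) e.
Proof.
move=> fe ge; have [U [oU Ue fgn]] := smooth_germ2 fe ge.
by exists U; split => // n; have [] := fgn n; exact: TCn_add.
Qed.

Lemma smooth_germ_scale E F (k : E -> R^o) (f : E -> F) e :
  smooth_germ k e -> smooth_germ f e -> smooth_germ (fun x => k x *: f x) e.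
Proof.
move=> ke fe; have [U [oU Ue kfn]] := smooth_germ2 ke fe.
by exists U; split => // n; have [] := kfn n; exact: TCn_scale.
Qed.

Lemma smooth_germ_clin E F (l : E -> F) e : clinear l -> smooth_germ l e.
Proof.
by move=> cl; exists setT; split => //; [exact: openT|move=> n; exact: TCn_clin].
Qed.

Lemma smooth_germ_cst E F (c : F) (e : E) : smooth_germ (fun _ => c) e.
Proof. by exists setT; split => //; [exact: openT|move=> n; exact: TCn_cst]. Qed.

End Germs.

Section Atlases.
Context {R : realType}.

(** The properties of a chart that survive the passage from the base to the total
    space of a bundle. They do not mention the shape of the image, so that corners
    need no special treatment; the last one says that the coordinate map is an
    embedding. *)
Definition good_chart {X : topologicalType} {E : tvsType R} (c : chart X E) :=
  [/\ open (cdom c), (forall x, cdom c x -> cbwd c (cfwd c x) = x),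
      (forall x, cdom c x -> {for x, continuous (cfwd c)}) &
      (forall x N, cdom c x -> nbhs x N ->
         \forall e \near cfwd c x, forall y, cdom c y -> cfwd c y = e -> N y)].

Definition good_atlas {X : topologicalType} {E : tvsType R} (A : set (chart X E)) :=
  [/\ (forall c, A c -> good_chart c), (forall x, exists2 c, A c & cdom c x) &
      (forall c c' x, A c -> A c' -> cdom c x -> cdom c' x ->
         exists2 g, smooth_germ g (cfwd c x) &
           \forall y \near x, cfwd c' y = g (cfwd c y))].

(** One pair of charts is enough: over a good atlas the others follow, see
    smooth_at_charts, so that a proof may use the charts at hand. *)
Definition smooth_at {X Y : topologicalType} {E F : tvsType R}
    (A : set (chart X E)) (B : set (chart Y F)) (f : X -> Y) (x : X) :=
  {for x, continuous f} /\
  exists c c' g, [/\ A c, B c', cdom c x & cdom c' (f x)] /\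
    (smooth_germ g (cfwd c x) /\ \forall y \near x, cfwd c' (f y) = g (cfwd c y)).

Definition id_chart (E : tvsType R) : chart E E := Chart setT id id.
Definition id_atlas (E : tvsType R) : set (chart E E) := [set id_chart E].
Arguments id_atlas : clear implicits.

Section SmoothAt.
Context {X Y Z : topologicalType} {E F G : tvsType R}.
Context {A : set (chart X E)} {B : set (chart Y F)} {D : set (chart Z G)}.

Lemma good_cdom_near (c : chart X E) x : good_chart c -> cdom c x ->
  \forall y \near x, cdom c y.
Proof. by move=> [oc _ _ _] cx; exact: open_nbhs_nbhs. Qed.

Lemma smooth_at_charts (f : X -> Y) x c c' : good_atlas A -> good_atlas B ->
  smooth_at A B f x -> A c -> B c' -> cdom c x -> cdom c' (f x) ->
  exists2 g, smooth_germ g (cfwd c x) &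
    \forall y \near x, cfwd c' (f y) = g (cfwd c y).
Proof.
move=> [_ _ tA] [_ _ tB] [cf [c0 [c0' [g [[Ac0 Bc0 c0x c0fx] [sg gE]]]]]].
move=> Ac Bc' cx c'fx.
have [s ss sE] := tA _ _ _ Ac Ac0 cx c0x.
have [t st tE] := tB _ _ _ Bc0 Bc' c0fx c'fx.
have gx : g (cfwd c0 x) = cfwd c0' (f x) by rewrite (nbhs_singleton gE).
have sx : s (cfwd c x) = cfwd c0 x by rewrite (nbhs_singleton sE).
exists (t \o (g \o s)).
  apply: smooth_germ_comp; first by apply: smooth_germ_comp; rewrite ?sx.
  by rewrite /= sx gx.
have tE' : \forall y \near x, cfwd c' (f y) = t (cfwd c0' (f y)) by exact: cf tE.
near=> y => /=.
have -> : cfwd c' (f y) = t (cfwd c0' (f y)) by near: y.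
congr t; have -> : cfwd c0' (f y) = g (cfwd c0 y) by near: y.
by congr g; near: y.
Unshelve. all: by end_near. Qed.

Lemma smooth_at_comp (f : X -> Y) (h : Y -> Z) x : good_atlas B ->
  smooth_at A B f x -> smooth_at B D h (f x) -> smooth_at A D (h \o f) x.
Proof.
move=> [_ _ tB] [cf [c [c' [g [[Ac Bc' cx c'x] [sg gE]]]]]].
move=> [ch [d [d' [k [[Bd Dd' dx d'x] [sk kE]]]]]].
have [t st tE] := tB _ _ _ Bc' Bd c'x dx.
split; first exact: continuous_comp cf ch.
have gx : g (cfwd c x) = cfwd c' (f x) by rewrite (nbhs_singleton gE).
have tx : t (cfwd c' (f x)) = cfwd d (f x) by rewrite (nbhs_singleton tE).
exists c, d', (k \o (t \o g)); split => //; split.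
  apply: smooth_germ_comp; first by apply: smooth_germ_comp; rewrite ?gx.
  by rewrite /= gx tx.
have tE' : \forall y \near x, cfwd d (f y) = t (cfwd c' (f y)) by exact: cf tE.
have kE' : \forall y \near x, cfwd d' (h (f y)) = k (cfwd d (f y)) by exact: cf kE.
near=> y => /=.
have -> : cfwd d' (h (f y)) = k (cfwd d (f y)) by near: y.
congr k; have -> : cfwd d (f y) = t (cfwd c' (f y)) by near: y.
by congr t; near: y.
Unshelve. all: by end_near. Qed.

Lemma smooth_at_near (f f' : X -> Y) x : (\forall y \near x, f y = f' y) ->
  smooth_at A B f x -> smooth_at A B f' x.
Proof.
move=> ff' [cf [c [c' [g [[Ac Bc' cx c'x] [sg gE]]]]]].
have fx : f x = f' x := nbhs_singleton ff'.
split.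
  rewrite /prop_for /continuous_at -fx; refine (cvg_trans _ cf).
  exact: near_eq_cvg.
exists c, c', g; split; first by rewrite -fx.
split => //; near=> y.
have <- : f y = f' y by near: y.
by near: y.
Unshelve. all: by end_near. Qed.

Lemma smooth_at_cst (y0 : Y) x : good_atlas A -> good_atlas B ->
  smooth_at A B (fun _ => y0) x.
Proof.
move=> [_ cA _] [_ cB _]; split; first exact: cvg_cst.
have [c Ac cx] := cA x; have [c' Bc' c'y] := cB y0.
exists c, c', (fun=> cfwd c' y0); split => //; split; first exact: smooth_germ_cst.
by apply: nbhsW.
Qed.

Lemma smooth_at_id x : good_atlas A -> smooth_at A A id x.
Proof.
move=> [_ cA _]; split; first exact: cvg_id.
have [c Ac cx] := cA x; exists c, c, id; split => //; split; last by apply: nbhsW.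
by apply: smooth_germ_clin; exact: clin_id.
Qed.

End SmoothAt.

Section SmoothAtOperations.
Context {X Y Z : topologicalType} {E F G : tvsType R}.
Context {A : set (chart X E)} {B : set (chart Y F)} {D : set (chart Z G)}.

Lemma smooth_at_pair (f : X -> Y) (h : X -> Z) x :
  good_atlas A -> good_atlas D ->
  smooth_at A B f x -> smooth_at A D h x ->
  smooth_at A (prod_atlas B D) (fun y => (f y, h y)) x.
Proof.
move=> gA gD [cf [c [c' [g [[Ac Bc' cx c'x] [sg gE]]]]]] sh.
have [ch [_ [d' [_ [[_ Dd' _ d'x] _]]]]] := sh.
have [k sk kE] := smooth_at_charts gA gD sh Ac Dd' cx d'x.
split; first exact: cvg_pair_nbhs.
exists c, (prod_chart c' d'), (fun e => (g e, k e)); split.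
  by split => //; exists c', d'.
split; first exact: smooth_germ_pair.
near=> y => /=.
have -> : cfwd c' (f y) = g (cfwd c y) by near: y.
by have -> : cfwd d' (h y) = k (cfwd c y) by near: y.
Unshelve. all: by end_near. Qed.

Lemma smooth_at_fst (z : X * Y) : good_atlas A -> good_atlas B ->
  smooth_at (prod_atlas A B) A fst z.
Proof.
move=> [_ cA _] [_ cB _]; split; first exact: cvg_fst.
have [c Ac cx] := cA z.1; have [c' Bc' c'y] := cB z.2.
exists (prod_chart c c'), c, fst; split; first by split => //; exists c, c'.
split; last by apply: nbhsW.
by apply: smooth_germ_clin; exact: clin_fst.
Qed.

Lemma smooth_at_snd (z : X * Y) : good_atlas A -> good_atlas B ->
  smooth_at (prod_atlas A B) B snd z.
Proof.
move=> [_ cA _] [_ cB _]; split; first exact: cvg_snd.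
have [c Ac cx] := cA z.1; have [c' Bc' c'y] := cB z.2.
exists (prod_chart c c'), c', snd; split; first by split => //; exists c, c'.
split; last by apply: nbhsW.
by apply: smooth_germ_clin; exact: clin_snd.
Qed.

Lemma smooth_at_cfwd c x : A c -> good_chart c -> cdom c x ->
  smooth_at A (id_atlas E) (cfwd c) x.
Proof.
move=> Ac [_ _ cc _] cx; split; first exact: cc.
exists c, (id_chart E), id; split => //; split; last by apply: nbhsW.
by apply: smooth_germ_clin; exact: clin_id.
Qed.

Lemma smooth_at_addE (f g : X -> F) x : good_atlas A -> good_atlas (id_atlas F) ->
  smooth_at A (id_atlas F) f x -> smooth_at A (id_atlas F) g x ->
  smooth_at A (id_atlas F) (fun y => f y + g y) x.
Proof.
move=> gA gF sf sg.
have [_ cA _] := gA; have [c Ac cx] := cA x.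
have [f' sf' fE] := smooth_at_charts gA gF sf Ac (erefl _) cx I.
have [g' sg' gE] := smooth_at_charts gA gF sg Ac (erefl _) cx I.
split; first exact: tvs_cvgD (proj1 sf) (proj1 sg).
exists c, (id_chart F), (fun e => f' e + g' e); split => //; split.
  exact: smooth_germ_add.
rewrite /= in fE gE *; near=> y.
have -> : f y = f' (cfwd c y) by near: y.
by have -> : g y = g' (cfwd c y) by near: y.
Unshelve. all: by end_near. Qed.

Lemma smooth_at_scaleE (k : X -> R^o) (f : X -> F) x : good_atlas A ->
  good_atlas (id_atlas F) -> good_atlas (id_atlas R^o) ->
  smooth_at A (id_atlas R^o) k x -> smooth_at A (id_atlas F) f x ->
  smooth_at A (id_atlas F) (fun y => k y *: f y) x.
Proof.
move=> gA gF gR sk sf.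
have [_ cA _] := gA; have [c Ac cx] := cA x.
have [f' sf' fE] := smooth_at_charts gA gF sf Ac (erefl _) cx I.
have [k' sk' kE] := smooth_at_charts gA gR sk Ac (erefl _) cx I.
split; first exact: tvs_cvgZ (proj1 sk) (proj1 sf).
exists c, (id_chart F), (fun e => k' e *: f' e); split => //; split.
  exact: smooth_germ_scale.
rewrite /= in fE kE *; near=> y.
have -> : f y = f' (cfwd c y) by near: y.
by have -> : k y = k' (cfwd c y) by near: y.
Unshelve. all: by end_near. Qed.

Lemma smooth_map_on_at (W : set X) (f : X -> Y) x : hausdorff_space F ->
  good_atlas A -> good_atlas B -> open W -> W x ->
  smooth_map_on A B W f -> smooth_at A B f x.
Proof.
move=> hF [hA cA _] [hB cB _] oW Wx [cf sf].
have cfx := within_open_continuous oW Wx cf.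
split => //.
have [c Ac cx] := cA x; have [c' Bc' c'x] := cB (f x).
have [oc bf cc _] := hA c Ac.
have [|U [g [oU Uc gC gE]]] := sf c c' Ac Bc' (cfwd c x); first by exists x.
exists c, c', g; split => //; split.
  by exists U; split => // n; exact: Cn_TCn.
have Wn : \forall y \near x, W y by exact: open_nbhs_nbhs.
have cn : \forall y \near x, cdom c y by exact: open_nbhs_nbhs.
have fn : \forall y \near x, cdom c' (f y).
  by apply: cfx; exact: good_cdom_near (hB _ Bc') c'x.
have Un : \forall y \near x, U (cfwd c y) by apply: (cc x cx); exact: open_nbhs_nbhs.
near=> y.
have cy : cdom c y by near: y.
have -> : g (cfwd c y) = (cfwd c' \o f \o cbwd c) (cfwd c y).
  rewrite gE//; last by near: y.
  by exists y => //; split; [split; near: y|near: y].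
by rewrite /= bf.
Unshelve. all: by end_near. Qed.

Lemma smooth_at_map_on (f : X -> Y) : hausdorff_space F ->
  good_atlas A -> good_atlas B -> (forall x, smooth_at A B f x) ->
  smooth_map_on A B setT f.
Proof.
move=> hF gA gB sf; split.
  by apply: continuous_subspaceT => x; exact: (proj1 (sf x)).
move=> c c' Ac Bc' _ [x [[_ cx] c'x] <-].
have [oc bf cc ci] := (let: And3 hA _ _ := gA in hA) c Ac.
have [g [U [oU Ux gn]] gE] := smooth_at_charts gA gB (sf x) Ac Bc' cx c'x.
have [V [oV Vx VE]] := nbhs_openS (ci x _ cx gE).
exists (U `&` V), g; split.
- exact: openI.
- by [].
- move=> n; apply: TCn_Cn => //; first exact: openI.
  by apply: TCn_sub (gn n) => y [].
- move=> _ [y [[_ cy] c'y] <-] [_ Vy] /=.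
  by rewrite bf// (VE _ Vy y).
Qed.

End SmoothAtOperations.

Lemma good_id_atlas (E : tvsType R) : good_atlas (id_atlas E).
Proof.
split.
- move=> _ ->; split => //=; first exact: openT.
  + by move=> x _; exact: cvg_id.
  + by move=> x N _ nN; apply: filterS nN => e Ne y _ ->.
- by move=> x; exists (id_chart E).
- move=> _ _ x -> -> _ _; exists id; last by apply: nbhsW.
  by apply: smooth_germ_clin; exact: clin_id.
Qed.

Lemma is_atlas_good {X : topologicalType} {E : tvsType R} (Q : set E)
    (A : set (chart X E)) : hausdorff_space E -> is_atlas Q A -> good_atlas A.
Proof.
move=> hE [hA cA tA].
have gA c : A c -> good_chart c.
  move=> /hA[oc _ bf cc ci]; split => //.
    by move=> x cx; exact: within_open_continuous oc cx cc.
  move=> x N cx nN.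
  have cix : (cfwd c @` cdom c) (cfwd c x) by exists x.
  have nN' : nbhs (cbwd c (cfwd c x)) N by rewrite bf.
  have H : nbhs (cfwd c x) (fun e => (cfwd c @` cdom c) e -> N (cbwd c e)).
    by move/subspace_continuousP: ci => /(_ (cfwd c x) cix N nN').
  apply: filterS H => e He y cy ye; have := He _.
  by rewrite -ye bf//; apply; exists y.
split => // c c' x Ac Ac' cx c'x.
have [|U [g [oU Ux gC gE]]] := tA c c' Ac Ac' (cfwd c x); first by exists x.
exists g; first by exists U; split => // n; exact: Cn_TCn.
have [oc bf cc _] := gA c Ac; have [oc' _ _ _] := gA c' Ac'.
have cn : \forall y \near x, cdom c y by exact: open_nbhs_nbhs.
have cn' : \forall y \near x, cdom c' y by exact: open_nbhs_nbhs.
have Un : \forall y \near x, U (cfwd c y) by apply: (cc x cx); exact: open_nbhs_nbhs.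
near=> y.
have cy : cdom c y by near: y.
have c'y : cdom c' y by near: y.
rewrite -gE /=; first by rewrite bf.
- by exists y.
- by near: y.
Unshelve. all: by end_near. Qed.

Lemma is_atlas_smooth_cbwd {X : topologicalType} {E : tvsType R}
    (A : set (chart X E)) c e : is_atlas setT A -> A c -> (cfwd c @` cdom c) e ->
  smooth_at (id_atlas E) A (cbwd c) e.
Proof.
move=> [hA _ _] Ac ce; have [oc [V oV VE] bf cc ci] := hA c Ac.
rewrite setIT in VE.
split; first by apply: (within_open_continuous _ ce ci); rewrite VE.
exists (id_chart E), c, id; split.
  by split => //; case: ce => x cx <-; rewrite bf.
split; first by apply: smooth_germ_clin; exact: clin_id.
have : nbhs e V by apply: open_nbhs_nbhs; split => //; rewrite -VE.
apply: filterS => y; rewrite -VE => -[x cx <-] /=.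
by rewrite bf.
Qed.

Lemma good_prod_atlas {X Y : topologicalType} {E F : tvsType R}
    (A : set (chart X E)) (B : set (chart Y F)) :
  good_atlas A -> good_atlas B -> good_atlas (prod_atlas A B).
Proof.
move=> [hA cA tA] [hB cB tB]; split.
- move=> _ [c [c' [Ac Bc' ->]]].
  have [oc bf cc ci] := hA c Ac; have [oc' bf' cc' ci'] := hB c' Bc'.
  split => /=.
  + exact: openX.
  + by move=> [x y] [/= cx cy]; rewrite bf// bf'.
  + move=> [x y] [/= cx cy]; apply: cvg_pair_nbhs.
      exact: (@cvg_comp _ _ _ fst (cfwd c) _ _ _ cvg_fst (cc x cx)).
    exact: (@cvg_comp _ _ _ snd (cfwd c') _ _ _ cvg_snd (cc' y cy)).
  + move=> [x y] N [/= cx cy] [[N1 N2] /= [n1 n2] NN].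
    exists ([set e | forall x, cdom c x -> cfwd c x = e -> N1 x],
            [set e | forall y, cdom c' y -> cfwd c' y = e -> N2 y]).
      by split; [exact: ci|exact: ci'].
    move=> [e1 e2] /= [h1 h2] [x' y'] /= [cx' cy'] [e1E e2E].
    by apply: NN; split => /=; [exact: h1|exact: h2].
- move=> [x y]; have [c Ac cx] := cA x; have [c' Bc' c'y] := cB y.
  by exists (prod_chart c c') => //; exists c, c'.
- move=> _ _ [x y] [c [c' [Ac Bc' ->]]] [d [d' [Ad Bd' ->]]] /= [/= cx cy] [/= dx dy].
  have [g sg gE] := tA _ _ _ Ac Ad cx dx.
  have [g' sg' gE'] := tB _ _ _ Bc' Bd' cy dy.
  exists (fun z => (g z.1, g' z.2)).
    apply: smooth_germ_pair.
      apply: (smooth_germ_comp (g := fst) (h := g)) => //.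
      by apply: smooth_germ_clin; exact: clin_fst.
    apply: (smooth_germ_comp (g := snd) (h := g')) => //.
    by apply: smooth_germ_clin; exact: clin_snd.
  exists ([set x | cfwd d x = g (cfwd c x)], [set y | cfwd d' y = g' (cfwd c' y)]).
    by split.
  by move=> [x' y'] [/= -> ->].
Qed.

End Atlases.

Arguments id_atlas {R} E.

(** * Locally finite covers of a manifold with corners *)

Section FiniteCovers.

Lemma finite_near {T X : Type} {F : set_system X} {FF : Filter F} (S : set T)
    (P : T -> X -> Prop) : finite_set S ->
  (forall i, S i -> \forall x \near F, P i x) ->
  \forall x \near F, forall i, S i -> P i x.
Proof.
move=> /(@finite_seqP {classic T})[s ->] /=; elim: s => [|i s IH] H.
  by apply: filterS filterT.
have h1 : \forall x \near F, P i x by apply: H; exact: mem_head.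
have h2 : \forall x \near F, forall j, j \in s -> P j x.
  by apply: IH => j js; apply: H; rewrite /= inE js orbT.
apply: filterS2 h1 h2 => x Pi Ps j /=.
by rewrite inE => /orP[/eqP ->|/Ps].
Qed.

(** Near-covering by the filter of finite sequences that eventually contain each
    given point. *)
Lemma compact_finite_cover {X : topologicalType} (B : set X) (G : X -> set X) :
  compact B -> (forall x, B x -> nbhs x (G x)) ->
  exists s : seq X, forall y, B y -> exists x, [/\ x \in s, B x & G x y].
Proof.
move=> /compact_near_coveringP cB BG.
pose F : set_system (seq X) :=
  filter_from setT (fun s : seq X => [set s' : seq X | {subset s <= s'}]).
have FF : Filter F.
  apply: filter_from_filter; first by exists [::].
  move=> s t _ _; exists (s ++ t) => //= u stu; split => x xs; apply: stu;
  by rewrite mem_cat xs ?orbT.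
have [|s _ sB] := cB (seq X) F (fun s y => exists x, [/\ x \in s, B x & G x y]) FF.
  move=> x Bx; exists (G x, [set s : seq X | x \in s]) => /=.
    split; first exact: BG.
    by exists [:: x] => //= s; apply; exact: mem_head.
  by move=> [y s] /= [Gxy xs]; exists x.
by exists s => y By; exact: (sB s (fun x xs => xs) y By).
Qed.

End FiniteCovers.

Definition lf_family {X : topologicalType} {I : Type} (U : I -> set X) :=
  forall x : X, exists2 N, nbhs x N & finite_set [set i | U i `&` N !=set0].

(** Near a point only finitely many members matter, and finitely many complements
    of closures intersect in a neighborhood. *)
Lemma closure_lf_union {X : topologicalType} {I : Type} (U : I -> set X)
    (S : set I) : lf_family U ->
  closure (\bigcup_(i in S) U i) `<=` \bigcup_(i in S) closure (U i).
Proof.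
move=> lfU x clx; apply: contrapT => nx.
have [N nN finN] := lfU x.
have : \forall y \near x, forall i, [set i | U i `&` N !=set0] i ->
    S i -> ~ U i y.
  apply: finite_near => // i _.
  have [Si|nSi] := pselect (S i); last by apply: nbhsW.
  have ncl : ~ closure (U i) x by move=> cli; apply: nx; exists i.
  have : nbhs x (~` closure (U i)).
    by apply: open_nbhs_nbhs; split => //; apply: closed_openC; exact: closed_closure.
  by apply: filterS => y ny _ Uy; apply: ny; exact: subset_closure.
move=> H; have [y [[i Si Uiy] [Ny Hy]]] := clx _ (filterI nN H).
by apply: (Hy i) => //; exists y.
Qed.

Lemma locally_finite_lf {X : topologicalType} (V : set (set X)) :
  locally_finite V -> lf_family (fun i : {B | V B} => sval i).
Proof.
move=> lfV x; have [N nN finN] := lfV x; exists N => //.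
have -> : [set i : {B | V B} | sval i `&` N !=set0] =
    sval @^-1` [set B | V B /\ B `&` N !=set0].
  by apply/seteqP; split => [[B VB] /= H|[B VB] /= []].
apply: finite_preimage finN => -[B VB] [B' VB'] _ _ /= BB'.
by subst B'; congr exist; exact: Prop_irrelevance.
Qed.

Lemma closure_lf_closure {X : topologicalType} {I : Type} (U : I -> set X) :
  lf_family U -> lf_family (fun i => closure (U i)).
Proof.
move=> lfU x; have [N nN finN] := lfU x.
have [G [oG Gx GN]] := nbhs_openS nN.
exists G; first exact: open_nbhs_nbhs.
apply: sub_finite_set finN => i /= [y [cly Gy]].
have [z [Uz Gz]] := cly G (open_nbhs_nbhs (conj oG Gy)).
by exists z; split => //; exact: GN.
Qed.

Section Covers.
Context {X : topologicalType}.
Hypothesis pX : paracompact X.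
Hypothesis regX : forall (x : X) O, nbhs x O ->
  exists G, [/\ open G, G x & closure G `<=` O].

Lemma refine_cover (good : set X -> Prop) :
  (forall x, exists G, [/\ open G, G x & good G]) ->
  exists V : set (set X), [/\ (forall B, V B -> open B),
    \bigcup_(B in V) B = setT, locally_finite V &
    forall B, V B -> exists2 G, good G & B `<=` G].
Proof.
move=> hG; have [|V [[oV cV] lV rV]] := pX (V := [set G | open G /\ good G]).
  split; first by move=> B [].
  apply/seteqP; split => // x _; have [G [oG Gx gG]] := hG x.
  by exists G.
exists V; split => // B VB; have [G [_ gG] BG] := rV B VB.
by exists G.
Qed.

(** Take a locally finite refinement of a cover whose members meet C only if their
    closure is in V, and let T be the union of those that meet C. *)
Lemma closed_open_between (C V : set X) : closed C -> open V -> C `<=` V ->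
  exists T, [/\ open T, C `<=` T & closure T `<=` V].
Proof.
move=> cC oV CV.
have [x|W [oW cW lW rW]] := refine_cover (good := fun G => closure G `<=` V \/ G `&` C = set0).
  have [Cx|nCx] := pselect (C x).
    have [|G [oG Gx GV]] := @regX x V; first by apply: open_nbhs_nbhs; split => //; exact: CV.
    by exists G; split => //; left.
  exists (~` C); split => //; first exact: closed_openC.
  by right; rewrite setICl.
pose S : set {B | W B} := [set i | sval i `&` C !=set0].
exists (\bigcup_(i in S) sval i); split.
- by apply: bigcup_open => -[B WB] _; exact: oW.
- move=> x Cx; have : (\bigcup_(B in W) B) x by rewrite cW.
  by move=> [B WB Bx]; exists (exist _ B WB) => //; exists x.
- apply: subset_trans (closure_lf_union (locally_finite_lf lW)) _ => x.
  move=> [[B WB] /= [y [By Cy]] clx].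
  have [G gG BG] := rW B WB; case: gG => [GV|G0].
    by apply: GV; apply: closureS BG _ clx.
  have : (G `&` C) y by split => //; exact: BG.
  by rewrite G0.
Qed.

(** D B collects the members of a locally finite refinement whose closure lies in
    B; its closure is still in B by local finiteness. *)
Lemma shrink_cover (V : set (set X)) : (forall B, V B -> open B) ->
  \bigcup_(B in V) B = setT -> exists D : set X -> set X,
  [/\ (forall B, V B -> closed (D B)), (forall B, V B -> D B `<=` B) &
      \bigcup_(B in V) D B = setT].
Proof.
move=> oV cV.
have [x|W [oW cW lW rW]] :=
    refine_cover (good := fun G => exists2 B, V B & closure G `<=` B).
  have : (\bigcup_(B in V) B) x by rewrite cV.
  move=> [B VB Bx]; have [|G [oG Gx GB]] := @regX x B.
    by apply: open_nbhs_nbhs; split => //; exact: oV.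
  by exists G; split => //; exists B.
pose S B : set {B | W B} := [set i | closure (sval i) `<=` B].
exists (fun B => closure (\bigcup_(i in S B) sval i)); split.
- by move=> B _; exact: closed_closure.
- move=> B _; apply: subset_trans (closure_lf_union (locally_finite_lf lW)) _ => x.
  by move=> [i]; apply.
- apply/seteqP; split => // x _.
  have : (\bigcup_(B in W) B) x by rewrite cW.
  move=> [B WB Bx]; have [G [B' VB' GB'] BG] := rW B WB.
  exists B' => //; apply: subset_closure; exists (exist _ B WB) => //.
  by apply: subset_trans GB'; exact: closureS.
Qed.

End Covers.

Lemma nbhs_rV {R : realType} {d} (a : 'rV[R]_d) (N : set 'rV[R]_d) : nbhs a N ->
  exists2 e : R, 0 < e &
    forall y : 'rV[R]_d, (forall i, `|y ord0 i - a ord0 i| < e) -> N y.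
Proof.
move=> /nbhs_ballP [e /= e0 eN]; exists e => // y ye; apply: eN; split => // i j.
by rewrite (ord1 i) /ball /= distrC.
Qed.

Section CornerManifold.
Context {R : realType} {d : nat} {M : topologicalType}.
Context {AM : set (chart M 'rV[R]_d)}.
Hypothesis M_corners : is_manifold_with_corners AM.

Let hM : hausdorff_space M. Proof. by case: M_corners. Qed.

Lemma corner_good_atlas : good_atlas AM.
Proof.
case: M_corners => _ _ aM; apply: (is_atlas_good _ aM).
exact: norm_hausdorff.
Qed.

(** A box of the orthant is compact, so its image D in M is compact, hence closed,
    and the bump function extended by 0 outside the chart is smooth across the
    boundary of the chart domain. *)
Lemma smooth_bump (x : M) (O : set M) : nbhs x O ->
  exists (l : M -> R^o) (D : set M),
  [/\ [/\ compact D, closed D & D `<=` O],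
      (forall y, smooth_at AM (id_atlas R^o) l y),
      (forall y, 0 <= l y /\ l y <= 1),
      (forall y, l y != 0 -> D y) &
      \forall y \near x, l y = 1].
Proof.
move=> nO; have gM := corner_good_atlas.
have [hA cA _] := gM.
have [_ _ [cA' _ _]] := M_corners.
have [c Ac cx] := cA x.
have [oc bf cc ci] := hA c Ac.
have [_ [V oV VE] _ _ cb] := cA' c Ac.
have H0 : nbhs x (O `&` cdom c) by apply: filterI => //; exact: open_nbhs_nbhs.
have H1 := ci x _ cx H0.
have H2 : nbhs (cfwd c x) V.
  apply: open_nbhs_nbhs; split => //.
  by have : (cfwd c @` cdom c) (cfwd c x) by [exists x]; rewrite VE => -[].
have [e e0 eN] := nbhs_rV (filterI H1 H2).
(* the bump lives in the box of radius 2 r < e *)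
pose a := cfwd c x; pose r := e / 3.
have r0 : 0 < r by rewrite divr_gt0.
have [b [bn b01 b1 bs]] := bump_rV a r0.
pose Q : set 'rV[R]_d := [set y | forall i,
  (`[Num.max 0 (a ord0 i - 2 * r), a ord0 i + 2 * r]%classic : set R) (y ord0 i)].
have cQ : compact Q.
  exact: (@rV_compact R d (fun i =>
    `[Num.max 0 (a ord0 i - 2 * r), a ord0 i + 2 * r]%classic)
    (fun i => @segment_compact R _ _)).
have Qnear y : Q y -> forall i, `|y ord0 i - a ord0 i| < e.
  move=> Qy i; have := Qy i; rewrite /= in_itv /= ge_max => /andP[/andP[_ h1] h2].
  by rewrite ltr_norml; apply/andP; split; rewrite /r in h1 h2; lra.
have Qimg : Q `<=` cfwd c @` cdom c.
  move=> y Qy; rewrite VE; split; first by case: (eN y (Qnear y Qy)).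
  by move=> i; have := Qy i; rewrite /= in_itv /= ge_max => /andP[/andP[]].
pose D := cbwd c @` Q.
have cD : compact D.
  by apply: continuous_compact cQ; exact: continuous_subspaceW Qimg cb.
have DO : D `<=` O `&` cdom c.
  move=> _ [y Qy <-]; have [z cz zy] := Qimg y Qy.
  have [/(_ z cz zy) Oz _] := eN y (Qnear y Qy).
  by rewrite -zy bf.
have clD : closed D by exact: compact_closed.
pose l y : R^o := if `[< cdom c y >] then b (cfwd c y) else 0.
have lD y : l y != 0 -> D y.
  rewrite /l; case: asboolP => [cy|_]; last by rewrite eqxx.
  move=> bn0; exists (cfwd c y); last exact: bf.
  move=> i; rewrite /= in_itv /= ge_max.
  have : (cfwd c @` cdom c) (cfwd c y) by exists y.
  rewrite VE => -[_ /(_ i) ->] /=.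
  have := bs _ bn0 i; rewrite ltr_norml => /andP[h1 h2].
  by apply/andP; split; rewrite /a in h1 h2 *; lra.
exists l, D; split => //.
- by split => // y /DO[].
- move=> y; have [cy|ncy] := pselect (cdom c y).
    have sb : smooth_at AM (id_atlas R^o) (b \o cfwd c) y.
      apply: (smooth_at_comp (@good_id_atlas R _)); first exact: smooth_at_cfwd.
      split; first exact: TCn_continuous (bn 0) I.
      exists (id_chart 'rV[R]_d), (id_chart R^o), b; split => //; split.
        by exists setT; split => //; exact: openT.
      by apply: nbhsW.
    apply: smooth_at_near sb.
    have : nbhs y (cdom c) by exact: open_nbhs_nbhs.
    by apply: filterS => z cz; rewrite /l asboolT.
  have s0 : smooth_at AM (id_atlas R^o) (fun _ => 0 : R^o) y.
    by apply: smooth_at_cst => //; exact: good_id_atlas.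
  apply: smooth_at_near s0.
  have : nbhs y (~` D).
    apply: open_nbhs_nbhs; split; first exact: closed_openC.
    by move=> /DO[].
  apply: filterS => z nDz; apply/esym; apply: contrapT => /eqP /lD.
  exact: nDz.
- by move=> y; rewrite /l; case: asboolP => _; [exact: b01|rewrite lexx ler01].
- have : nbhs (cfwd c x) [set y : 'rV[R]_d | forall i, `|y ord0 i - a ord0 i| <= r].
    apply/nbhs_ballP; exists r => //= y yr i.
    have := (proj2 yr) ord0 i; rewrite /ball /= distrC => h; exact: ltW.
  move=> H.
  have H3 : \forall y \near x, forall i, `|cfwd c y ord0 i - a ord0 i| <= r.
    exact: (cc x cx _ H).
  have H4 : nbhs x (cdom c) by exact: open_nbhs_nbhs.
  apply: filterS2 H3 H4 => y yr cy; rewrite /l asboolT//.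
  exact: b1.
Qed.

Lemma corner_regular (x : M) (O : set M) : nbhs x O ->
  exists G, [/\ open G, G x, compact (closure G) & closure G `<=` O].
Proof.
move=> nO; have [l [D [[cD clD DO] _ _ lD l1]]] := smooth_bump nO.
have [G [oG Gx GN]] := nbhs_openS l1.
have GD : closure G `<=` D.
  move=> y cly; apply: clD; apply: closureS cly => z Gz.
  by apply: lD; rewrite (GN z Gz) oner_neq0.
exists G; split => //.
  exact: (subclosed_compact (@closed_closure _ _) cD GD).
exact: subset_trans GD DO.
Qed.

End CornerManifold.

(** * Smooth structure of a principal bundle *)

Section LieGroup.
Context {R : realType} {E : tvsType R} {K : preTopologicalGroupType}.
Context {AK : set (chart K E)}.
Hypotheses (hE : hausdorff_space E) (K_lie : is_lie_group AK).

Lemma lie_good_atlas : good_atlas AK.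
Proof. by case: K_lie => -[_ aK] _ _; exact: is_atlas_good aK. Qed.

Lemma smooth_at_mulg (z : K * K) :
  smooth_at (prod_atlas AK AK) AK (fun z : K * K => (z.1 * z.2)%g) z.
Proof.
have gK := lie_good_atlas; case: K_lie => _ mK _.
apply: (@smooth_map_on_at _ _ _ _ _ _ _ setT) => //; first exact: good_prod_atlas.
exact: openT.
Qed.

Lemma continuous_mulg : continuous (fun z : K * K => (z.1 * z.2)%g).
Proof. by move=> z; exact: (proj1 (smooth_at_mulg z)). Qed.

Lemma continuous_invg : continuous (fun z : K => (z^-1)%g).
Proof.
case: K_lie => _ _ [iK _] z; apply: (within_open_continuous _ _ iK) => //.
exact: openT.
Qed.

Lemma smooth_at_mulg_comp {X : topologicalType} {G : tvsType R}
    {A : set (chart X G)} (f g : X -> K) x : good_atlas A ->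
  smooth_at A AK f x -> smooth_at A AK g x ->
  smooth_at A AK (fun y => (f y * g y)%g) x.
Proof.
have gK := lie_good_atlas => gA sf sg.
exact: (smooth_at_comp (h := fun z : K * K => (z.1 * z.2)%g)
  (good_prod_atlas gK gK) (smooth_at_pair gA gK sf sg) (smooth_at_mulg _)).
Qed.

End LieGroup.

Section Trivializations.
Context {M P : topologicalType} {K : preTopologicalGroupType}.
Context {eta : P -> M} {act : P -> K -> P} {t : triv M P K}.
Hypotheses (tt : is_triv eta act t) (ceta : continuous eta).

Lemma triv_open : open (tdom t). Proof. by case: tt. Qed.

Lemma triv_fst p : tdom t (eta p) -> (tfwd t p).1 = eta p.
Proof. by case: tt => _ H _ _ _; exact: H. Qed.

Lemma triv_pair p : tdom t (eta p) -> tfwd t p = (eta p, (tfwd t p).2).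
Proof. by move=> tp; rewrite -(triv_fst tp) -surjective_pairing. Qed.

Lemma triv_act p k : tdom t (eta p) ->
  tdom t (eta (act p k)) /\ tfwd t (act p k) = ((tfwd t p).1, ((tfwd t p).2 * k)%g).
Proof. by case: tt => _ _ H _ _; exact: H. Qed.

Lemma triv_fwdK p : tdom t (eta p) -> tbwd t (tfwd t p) = p.
Proof. by case: tt => _ _ _ [H _] _; exact: H. Qed.

Lemma triv_bwdK x k : tdom t x -> tfwd t (tbwd t (x, k)) = (x, k).
Proof. by case: tt => _ _ _ [_ H] _ /(H x k)[]. Qed.

Lemma triv_bwd_dom x k : tdom t x -> tdom t (eta (tbwd t (x, k))).
Proof. by case: tt => _ _ _ [_ H] _ /(H x k)[]. Qed.

Lemma triv_bwd_eta x k : tdom t x -> eta (tbwd t (x, k)) = x.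
Proof. by move=> tx; rewrite -triv_fst ?triv_bwdK//; exact: triv_bwd_dom. Qed.

Lemma triv_bwdM x k l : tdom t x -> tbwd t (x, (k * l)%g) = act (tbwd t (x, k)) l.
Proof.
move=> tx; have [d e] := triv_act l (triv_bwd_dom k tx).
by rewrite -(triv_fwdK d) e triv_bwdK.
Qed.

Lemma triv_near p : tdom t (eta p) -> \forall q \near p, tdom t (eta q).
Proof. by move=> tp; apply: (ceta); apply: open_nbhs_nbhs; split => //; exact: triv_open. Qed.

Lemma triv_fwd_continuous p : tdom t (eta p) -> {for p, continuous (tfwd t)}.
Proof.
move=> tp; case: tt => ot _ _ _ [cf _]; apply: (within_open_continuous _ _ cf) => //.
by apply: open_comp ot => q _; exact: ceta.
Qed.

Lemma triv_bwd_continuous x k : tdom t x -> {for (x, k), continuous (tbwd t)}.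
Proof.
move=> tx; case: tt => ot _ _ _ [_ cb]; apply: (within_open_continuous _ _ cb) => //.
by apply: openX => //; exact: openT.
Qed.

End Trivializations.

Section BundleAtlas.
Context {R : realType} {E : tvsType R} {K : preTopologicalGroupType}.
Context {AK : set (chart K E)} {d : nat} {M : topologicalType}.
Context {AM : set (chart M 'rV[R]_d)}.
Hypotheses (hE : hausdorff_space E) (K_lie : is_lie_group AK)
  (M_corners : is_manifold_with_corners AM).

Let gM : good_atlas AM. Proof. exact: corner_good_atlas. Qed.
Let gK : good_atlas AK. Proof. exact: lie_good_atlas. Qed.
Let gMK : good_atlas (prod_atlas AM AK). Proof. exact: good_prod_atlas. Qed.

Variable P : smooth_bundle AM AK.
Local Notation eta := (proj P).
Local Notation trivP := (@trivs _ _ _ _ _ AM AK P).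

Let ceta : continuous eta. Proof. exact: (@Defs.proj_continuous _ _ P). Qed.

(** In two trivializations the change is (x, k) |-> (x, g x * k) with g a transition
    function. *)
Lemma triv_transition_smooth s t x k : trivP s -> trivP t ->
  tdom s x -> tdom t x ->
  smooth_at (prod_atlas AM AK) (prod_atlas AM AK)
    (fun z => tfwd s (tbwd t z)) (x, k).
Proof.
move=> Ps Pt sx tx.
have ts := trivs_triv Ps; have tt := trivs_triv Pt.
have [g [gE sg]] := trivs_smooth Ps Pt.
have oW : open (tdom s `&` tdom t).
  by apply: openI; [exact: triv_open ts|exact: triv_open tt].
have sgx : smooth_at AM AK g x.
  by apply: (smooth_map_on_at hE gM gK oW _ sg); split.
have tE y a : tdom s y -> tdom t y -> tfwd s (tbwd t (y, a)) = (y, (g y * a)%g).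
  move=> sy ty; rewrite -[in LHS](mul1g a) (triv_bwdM tt)// -gE//.
  by rewrite -actM -(triv_bwdM ts)// mul1g (triv_bwdK ts).
have S : smooth_at (prod_atlas AM AK) (prod_atlas AM AK)
    (fun z : M * K => (z.1, (g z.1 * z.2)%g)) (x, k).
  apply: smooth_at_pair => //; first exact: smooth_at_fst.
  apply: smooth_at_mulg_comp => //; last exact: smooth_at_snd.
  exact: (smooth_at_comp gM (smooth_at_fst (x, k) gM gK) sgx).
apply: smooth_at_near S.
exists (tdom s `&` tdom t, setT) => /=.
  by split; [exact: open_nbhs_nbhs|exact: filterT].
by move=> [y a] [/= [sy ty] _]; rewrite tE.
Qed.

Lemma triv_chart_good t (c : chart (M * K)%type ('rV[R]_d * E)%type) : trivP t -> good_chart c ->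
  good_chart (triv_chart (P := P) t c).
Proof.
move=> Pt [oc bf cc ci]; have tt := trivs_triv Pt.
split => /=.
- rewrite openE => p [tp cp]; apply: filterI; first exact: (triv_near tt ceta tp).
  by apply: (triv_fwd_continuous tt ceta tp); exact: open_nbhs_nbhs.
- by move=> p [tp cp]; rewrite bf// (triv_fwdK tt).
- move=> p [tp cp]; apply: continuous_comp; last exact: cc.
  exact: (triv_fwd_continuous tt ceta tp).
- move=> p N [tp cp] nN.
  have tfp : tdom t (tfwd t p).1 by rewrite (triv_fst tt).
  have : nbhs (tfwd t p) (tbwd t @^-1` N).
    have := @triv_bwd_continuous _ _ _ _ _ _ tt (tfwd t p).1 (tfwd t p).2 tfp.
    rewrite -surjective_pairing; apply.
    by rewrite (triv_fwdK tt).
  move=> /(ci _ _ cp); apply: filterS => e He q [tq cq] qe.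
  by rewrite -(triv_fwdK tt tq); exact: He.
Qed.

Lemma bundle_good_atlas : good_atlas (bundle_atlas P).
Proof.
have [hMK cMK tMK] := gMK; split.
- by move=> _ [t [c [Pt /hMK gc ->]]]; exact: triv_chart_good.
- move=> p; have [t Pt tp] := trivs_cover P (eta p).
  have [c Ac cp] := cMK (tfwd t p).
  by exists (triv_chart t c) => //; exists t, c.
- move=> _ _ p [t [c [Pt Ac ->]]] [s [c' [Ps Ac' ->]]] /= [tp cp] [sp c'p].
  have tt := trivs_triv Pt; have ts := trivs_triv Ps.
  have S := triv_transition_smooth (tfwd t p).2 Ps Pt sp tp.
  rewrite -(triv_pair tt tp) in S.
  have [|g sg gE] := smooth_at_charts gMK gMK S Ac Ac' cp.
    by rewrite (triv_fwdK tt).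
  exists g => //.
  have H : \forall q \near p, cfwd c' (tfwd s (tbwd t (tfwd t q))) = g (cfwd c (tfwd t q)).
    exact: (triv_fwd_continuous tt ceta tp gE).
  apply: filterS2 H (triv_near tt ceta tp) => q + tq.
  by rewrite (triv_fwdK tt).
Qed.

Lemma smooth_at_tfwd t p : trivP t -> tdom t (eta p) ->
  smooth_at (bundle_atlas P) (prod_atlas AM AK) (tfwd t) p.
Proof.
move=> Pt tp; have tt := trivs_triv Pt.
have [_ cMK _] := gMK; have [c Ac cp] := cMK (tfwd t p).
split; first exact: (triv_fwd_continuous tt ceta tp).
exists (triv_chart t c), c, id; split; first by split => //; exists t, c.
split; first by apply: smooth_germ_clin; exact: clin_id.
exact: nbhsW.
Qed.

Lemma smooth_at_tbwd t x k : trivP t -> tdom t x ->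
  smooth_at (prod_atlas AM AK) (bundle_atlas P) (tbwd t) (x, k).
Proof.
move=> Pt tx; have tt := trivs_triv Pt.
have [_ cMK _] := gMK; have [c Ac cp] := cMK (x, k).
split; first exact: (@triv_bwd_continuous _ _ _ _ _ _ tt x k tx).
exists c, (triv_chart t c), id; split.
  split => //; first by exists t, c.
  by split => /=; [exact: (triv_bwd_dom tt _ tx)|rewrite (triv_bwdK tt)].
split; first by apply: smooth_germ_clin; exact: clin_id.
exists (tdom t, setT) => /=.
  split; last exact: filterT.
  by apply: open_nbhs_nbhs; split => //; exact: triv_open tt.
by move=> [y a] [/= ty _]; rewrite (triv_bwdK tt).
Qed.

Lemma smooth_at_proj p : smooth_at (bundle_atlas P) AM eta p.
Proof.
have [t Pt tp] := trivs_cover P (eta p); have tt := trivs_triv Pt.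
have gP := bundle_good_atlas.
have := smooth_at_comp gMK (smooth_at_tfwd Pt tp) (smooth_at_fst _ gM gK).
apply: smooth_at_near; move: (triv_near tt ceta tp); apply: filterS => q tq /=.
by rewrite (triv_fst tt).
Qed.

Lemma smooth_at_section t x : trivP t -> tdom t x ->
  smooth_at AM (bundle_atlas P) (fun y => tbwd t (y, 1%g)) x.
Proof.
move=> Pt tx.
have S : smooth_at AM (prod_atlas AM AK) (fun y => (y, 1%g : K)) x.
  by apply: smooth_at_pair => //; [exact: smooth_at_id|exact: smooth_at_cst].
exact: (smooth_at_comp gMK S (smooth_at_tbwd 1%g Pt tx)).
Qed.

End BundleAtlas.

(** * Local representatives of bundle maps *)

Section BundleMaps.
Context {R : realType} {E : tvsType R} {K : preTopologicalGroupType}.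
Context {AK : set (chart K E)} {d : nat} {M : topologicalType}.
Context {AM : set (chart M 'rV[R]_d)}.
Hypotheses (hE : hausdorff_space E) (K_lie : is_lie_group AK)
  (M_corners : is_manifold_with_corners AM).
Variables (P P' : smooth_bundle AM AK).

Local Notation eta := (proj P).
Local Notation eta' := (proj P').
Local Notation trivP := (@trivs _ _ _ _ _ AM AK P).
Local Notation trivP' := (@trivs _ _ _ _ _ AM AK P').

Let gM : good_atlas AM. Proof. exact: corner_good_atlas. Qed.
Let gK : good_atlas AK. Proof. exact: lie_good_atlas. Qed.
Let gMK : good_atlas (prod_atlas AM AK). Proof. exact: good_prod_atlas. Qed.
Let gP : good_atlas (bundle_atlas P). Proof. exact: bundle_good_atlas. Qed.
Let gP' : good_atlas (bundle_atlas P'). Proof. exact: bundle_good_atlas. Qed.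
Let ceta : continuous eta. Proof. exact: (@Defs.proj_continuous _ _ P). Qed.
Let ceta' : continuous eta'. Proof. exact: (@Defs.proj_continuous _ _ P'). Qed.

Definition bundle_morphism (Om : P -> P') :=
  bundle_map Om /\ forall p, eta' (Om p) = eta p.

Definition smooth_over (Om : P -> P') (x : M) :=
  forall p, eta p = x -> smooth_at (bundle_atlas P) (bundle_atlas P') Om p.

Section Local.
Variables (t : triv M P K) (t' : triv M P' K).
Hypotheses (Pt : trivP t) (Pt' : trivP' t').
Let tt : is_triv eta (act P) t. Proof. exact: trivs_triv. Qed.
Let tt' : is_triv eta' (act P') t'. Proof. exact: trivs_triv. Qed.

Definition local_rep (Om : P -> P') (y : M) : K := (tfwd t' (Om (tbwd t (y, 1%g)))).2.

(** The map which has local representative g; it is equivariant because g acts by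
    left multiplication. *)
Definition of_local_rep (g : M -> K) (p : P) : P' :=
  tbwd t' (eta p, (g (eta p) * (tfwd t p).2)%g).

Lemma of_local_repK Om p : bundle_morphism Om ->
  tdom t (eta p) -> tdom t' (eta p) -> of_local_rep (local_rep Om) p = Om p.
Proof.
move=> [[_ Oact] Oeta] tp t'p; rewrite /of_local_rep (triv_bwdM tt')// /local_rep.
set q := tbwd t (eta p, 1%g).
have qE : eta q = eta p by rewrite (triv_bwd_eta tt).
have -> : (eta p, (tfwd t' (Om q)).2) = tfwd t' (Om q).
  by rewrite [RHS](triv_pair tt') Oeta qE.
rewrite (triv_fwdK tt') ?Oeta ?qE// -Oact; congr Om.
rewrite /q -(triv_bwdM tt)// mul1g.
by rewrite -(triv_pair tt)// (triv_fwdK tt).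
Qed.

Lemma of_local_rep_proj g p : tdom t' (eta p) -> eta' (of_local_rep g p) = eta p.
Proof. by move=> t'p; rewrite /of_local_rep (triv_bwd_eta tt'). Qed.

Lemma proj_act (Q : principal_bundle M K) p k : proj Q (act Q p k) = proj Q p.
Proof.
have [s ts sp] := locally_trivial Q (proj Q p).
have [sq e] := triv_act ts k sp.
by rewrite -(triv_fst ts sq) e /= (triv_fst ts).
Qed.

Lemma of_local_rep_act g p k : tdom t (eta p) -> tdom t' (eta p) ->
  of_local_rep g (act P p k) = act P' (of_local_rep g p) k.
Proof.
move=> tp t'p; rewrite /of_local_rep proj_act -(triv_bwdM tt')//.
by have [_ ->] := triv_act tt k tp; rewrite /= mulgA.
Qed.

Lemma of_local_rep_continuous g p : tdom t (eta p) -> tdom t' (eta p) ->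
  {for eta p, continuous g} -> {for p, continuous (of_local_rep g)}.
Proof.
move=> tp t'p cg.
have c1 : {for p, continuous (fun q => g (eta q))} by exact: (cvg_comp _ _ (@ceta p) cg).
have c2 : {for p, continuous (fun q => (tfwd t q).2)}.
  exact: (cvg_comp _ _ (triv_fwd_continuous tt ceta tp) cvg_snd).
have c3 := cvg_comp _ _ (cvg_pair_nbhs (FG := nbhs_filter p) c1 c2)
  (@continuous_mulg _ _ _ _ hE K_lie (g (eta p), (tfwd t p).2)).
have c4 := cvg_pair_nbhs (FG := nbhs_filter p) (@ceta p) c3.
exact: (cvg_comp _ _ c4 (@triv_bwd_continuous _ _ _ _ _ _ tt' _ _ t'p)).
Qed.

Lemma of_local_rep_smooth g p : tdom t (eta p) -> tdom t' (eta p) ->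
  smooth_at AM AK g (eta p) ->
  smooth_at (bundle_atlas P) (bundle_atlas P') (of_local_rep g) p.
Proof.
move=> tp t'p sg.
have seta := smooth_at_proj hE K_lie M_corners p.
have s1 := smooth_at_comp gM seta sg.
have s2 : smooth_at (bundle_atlas P) AK (snd \o tfwd t) p.
  apply: (smooth_at_comp gMK (smooth_at_tfwd hE K_lie M_corners Pt tp)).
  exact: smooth_at_snd.
have s3 := smooth_at_mulg_comp hE K_lie gP s1 s2.
have s4 := smooth_at_pair gP gK seta s3.
exact: (smooth_at_comp gMK s4 (smooth_at_tbwd hE K_lie M_corners _ Pt' t'p)).
Qed.

Lemma local_rep_continuous Om y : bundle_morphism Om -> tdom t y -> tdom t' y ->
  {for y, continuous (local_rep Om)}.
Proof.
move=> [[cO _] Oeta] ty t'y.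
have c1 : (fun y => (y, 1%g : K)) @ y --> (y, 1%g : K).
  by apply: cvg_pair_nbhs; [exact: cvg_id|exact: cvg_cst].
have c2 := cvg_comp _ _ c1 (@triv_bwd_continuous _ _ _ _ _ _ tt y 1%g ty).
have c3 := cvg_comp _ _ c2 (cO (tbwd t (y, 1%g))).
have t'q : tdom t' (eta' (Om (tbwd t (y, 1%g)))) by rewrite Oeta (triv_bwd_eta tt).
have c4 := cvg_comp _ _ c3 (triv_fwd_continuous tt' ceta' t'q).
exact: (cvg_comp _ _ c4 cvg_snd).
Qed.

Lemma local_rep_smooth Om y : bundle_morphism Om -> tdom t y -> tdom t' y ->
  smooth_at (bundle_atlas P) (bundle_atlas P') Om (tbwd t (y, 1%g)) ->
  smooth_at AM AK (local_rep Om) y.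
Proof.
move=> [[cO _] Oeta] ty t'y sO.
have s1 := smooth_at_comp gP (smooth_at_section hE K_lie M_corners Pt ty) sO.
have t'q : tdom t' (eta' (Om (tbwd t (y, 1%g)))) by rewrite Oeta (triv_bwd_eta tt).
have s2 := smooth_at_comp gP' s1 (smooth_at_tfwd hE K_lie M_corners Pt' t'q).
exact: (smooth_at_comp gMK s2 (smooth_at_snd _ gM gK)).
Qed.

(** By equivariance, smoothness at one point of a fiber spreads to the whole
    fiber. *)
Lemma smooth_over_section Om y : bundle_morphism Om -> tdom t y -> tdom t' y ->
  smooth_at (bundle_atlas P) (bundle_atlas P') Om (tbwd t (y, 1%g)) ->
  smooth_over Om y.
Proof.
move=> mO ty t'y sO p py.
have sg := local_rep_smooth mO ty t'y sO.
have s1 : smooth_at (bundle_atlas P) (bundle_atlas P') (of_local_rep (local_rep Om)) p.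
  by apply: of_local_rep_smooth; rewrite ?py.
have tp : tdom t (eta p) by rewrite py.
have t'p : tdom t' (eta p) by rewrite py.
apply: smooth_at_near s1.
have n1 := triv_near tt ceta tp.
have n2 : \forall q \near p, tdom t' (eta q).
  by apply: (@ceta p); apply: open_nbhs_nbhs; split => //; exact: triv_open tt'.
by apply: filterS2 n1 n2 => q tq t'q; exact: of_local_repK.
Qed.

Section Glue.
Variables (Om : P -> P') (U D : set M) (g : M -> K).
Hypotheses (mO : bundle_morphism Om) (oU : open U) (clD : closed D) (DU : D `<=` U)
  (Ut : U `<=` tdom t) (Ut' : U `<=` tdom t')
  (cg : forall y, U y -> {for y, continuous g})
  (gE : forall y, U y -> ~ D y -> g y = local_rep Om y).

(** Om with its local representative over U replaced by g. When g only differs from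
    the old representative on a closed subset D of U, the two pieces fit together
    along the boundary of U. *)
Definition reglue (p : P) : P' :=
  if `[< U (eta p) >] then of_local_rep g p else Om p.

Lemma reglue_in p : U (eta p) -> reglue p = of_local_rep g p.
Proof. by move=> Up; rewrite /reglue asboolT. Qed.

Lemma reglue_off p : ~ D (eta p) -> reglue p = Om p.
Proof.
move=> nDp; rewrite /reglue; case: asboolP => // Up.
rewrite -(of_local_repK mO (Ut Up) (Ut' Up)) /of_local_rep.
by rewrite gE.
Qed.

Lemma reglue_near_in p : U (eta p) -> \forall q \near p, of_local_rep g q = reglue q.
Proof.
move=> Up; have : \forall q \near p, U (eta q) by apply: (@ceta p); exact: open_nbhs_nbhs.
by apply: filterS => q Uq; rewrite reglue_in.
Qed.

Lemma reglue_near_off p : ~ D (eta p) -> \forall q \near p, Om q = reglue q.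
Proof.
move=> nDp; have : \forall q \near p, ~ D (eta q).
  apply: (@ceta p (~` D)); apply: open_nbhs_nbhs; split => //; exact: closed_openC.
by apply: filterS => q nDq; rewrite reglue_off.
Qed.

Lemma reglue_continuous : continuous reglue.
Proof.
move=> p; have [Up|nUp] := pselect (U (eta p)).
  have cp := of_local_rep_continuous (Ut Up) (Ut' Up) (cg Up).
  rewrite /continuous_at reglue_in//; refine (cvg_trans _ cp).
  by apply: near_eq_cvg; exact: reglue_near_in.
have nDp : ~ D (eta p) by move=> /DU.
rewrite /continuous_at reglue_off//; refine (cvg_trans _ (proj1 (proj1 mO) p)).
by apply: near_eq_cvg; exact: reglue_near_off.
Qed.

Lemma reglue_morphism : bundle_morphism reglue.
Proof.
split; first split; first exact: reglue_continuous.
  move=> p k; rewrite /reglue proj_act; case: asboolP => [Up|_].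
    by rewrite of_local_rep_act//; [exact: Ut|exact: Ut'].
  exact: (proj2 (proj1 mO)).
move=> p; rewrite /reglue; case: asboolP => [Up|_]; last exact: (proj2 mO).
by rewrite of_local_rep_proj//; exact: Ut'.
Qed.

Lemma reglue_smooth_in x : U x -> smooth_at AM AK g x -> smooth_over reglue x.
Proof.
move=> Ux sg p px.
have s : smooth_at (bundle_atlas P) (bundle_atlas P') (of_local_rep g) p.
  by apply: of_local_rep_smooth; rewrite ?px//; [exact: Ut|exact: Ut'].
by apply: smooth_at_near s; apply: reglue_near_in; rewrite px.
Qed.

Lemma reglue_smooth_off x : ~ D x -> smooth_over Om x -> smooth_over reglue x.
Proof.
move=> nDx sO p px; apply: smooth_at_near (sO p px).
by apply: reglue_near_off; rewrite px.
Qed.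

End Glue.
End Local.

(** In local trivializations the inverse is (x, k) |-> (x, (g x)^-1 * k) with g the
    local representative. *)
Lemma bundle_morphism_equivalence Om : bundle_morphism Om -> bundle_equivalence Om.
Proof.
move=> mO; have [[cO Oact] Oeta] := mO.
have triv2 x : exists t t', [/\ trivP t, trivP' t', tdom t x & tdom t' x].
  have [t Pt tx] := trivs_cover P x; have [t' Pt' t'x] := trivs_cover P' x.
  by exists t, t'.
pose inv t t' (q : P') : P :=
  tbwd t (eta' q, ((local_rep t t' Om (eta' q))^-1 * (tfwd t' q).2)%g).
have Oinv t t' q : trivP t -> trivP' t' -> tdom t (eta' q) -> tdom t' (eta' q) ->
    Om (inv t t' q) = q.
  move=> Pt Pt' tq t'q; have tt := trivs_triv Pt; have tt' := trivs_triv Pt'.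
  have e : eta (inv t t' q) = eta' q by rewrite /inv (triv_bwd_eta tt).
  rewrite -(of_local_repK Pt Pt' mO) ?e// /of_local_rep e /inv (triv_bwdK tt)//=.
  by rewrite mulgA mulgV mul1g -(triv_pair tt')// (triv_fwdK tt').
have injO : injective Om.
  move=> p q pq; have e : eta p = eta q by rewrite -!Oeta pq.
  have [t [t' [Pt Pt' tx t'x]]] := triv2 (eta p).
  have tt := trivs_triv Pt; have tt' := trivs_triv Pt'.
  have tq : tdom t (eta q) by rewrite -e.
  have := of_local_repK Pt Pt' mO tx t'x.
  rewrite pq -(of_local_repK Pt Pt' mO tq) -?e// /of_local_rep -e.
  move=> /(congr1 (tfwd t')); rewrite !(triv_bwdK tt')// => -[/mulgI epq].
  by rewrite -(triv_fwdK tt tx) -(triv_fwdK tt tq) (triv_pair tt tx) (triv_pair tt tq) epq e.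
have [Om' Om'K] : exists Om' : P' -> P, cancel Om' Om.
  suff /choice[Om' H] : forall q, exists p, Om p = q by exists Om'.
  move=> q; have [t [t' [Pt Pt' tx t'x]]] := triv2 (eta' q).
  by exists (inv t t' q); exact: Oinv.
have OmK : cancel Om Om' by move=> p; apply: injO; rewrite Om'K.
split => //.
exists Om'; split => //; split; last first.
  by move=> q k; apply: injO; rewrite Oact !Om'K.
move=> q; have [t [t' [Pt Pt' tq t'q]]] := triv2 (eta' q).
have tt := trivs_triv Pt; have tt' := trivs_triv Pt'.
have nE : \forall r \near q, inv t t' r = Om' r.
  have n1 := triv_near tt' ceta' t'q.
  have n2 : \forall r \near q, tdom t (eta' r).
    by apply: (@ceta' q); apply: open_nbhs_nbhs; split => //; exact: triv_open tt.
  apply: filterS2 n1 n2 => r t'r tr; apply: injO.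
  by rewrite Om'K Oinv.
have c1 : {for q, continuous (fun r => local_rep t t' Om (eta' r))}.
  exact: (cvg_comp _ _ (@ceta' q) (local_rep_continuous Pt Pt' mO tq t'q)).
have c2 := cvg_comp _ _ c1 (@continuous_invg _ _ _ _ K_lie _).
have c3 : {for q, continuous (fun r => (tfwd t' r).2)}.
  exact: (cvg_comp _ _ (triv_fwd_continuous tt' ceta' t'q) cvg_snd).
have c4 := cvg_comp _ _ (cvg_pair_nbhs (FG := nbhs_filter q) c2 c3)
  (@continuous_mulg _ _ _ _ hE K_lie (_, _)).
have c5 := cvg_pair_nbhs (FG := nbhs_filter q) (@ceta' q) c4.
have c6 := cvg_comp _ _ c5 (@triv_bwd_continuous _ _ _ _ _ _ tt _ _ tq).
rewrite /continuous_at -(nbhs_singleton nE).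
by refine (cvg_trans _ c6); apply: near_eq_cvg.
Qed.

End BundleMaps.

(** * Smoothing a vector-valued map on a compact set *)

Section LocalSmoothing.
Context {R : realType} {E : tvsType R} {d : nat} {M : topologicalType}.
Context {AM : set (chart M 'rV[R]_d)}.
Hypothesis M_corners : is_manifold_with_corners AM.
Let gM : good_atlas AM. Proof. exact: corner_good_atlas. Qed.

Local Notation smE := (smooth_at AM (id_atlas E)).

Lemma smooth_at_interpolate (l : M -> R^o) (f : M -> E) (c : E) y :
  smooth_at AM (id_atlas R^o) l y -> smE f y ->
  smE (fun z => (1 - l z) *: f z + l z *: c) y.
Proof.
move=> sl sf; have gE := good_id_atlas E; have gR := good_id_atlas R^o.
apply: smooth_at_addE => //; apply: smooth_at_scaleE => //; last exact: smooth_at_cst.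
have sN := smooth_at_scaleE gM gR gR (smooth_at_cst (-1 : R^o) y gM gR) sl.
have s1 := smooth_at_addE gM gR (smooth_at_cst (1 : R^o) y gM gR) sN.
by apply: smooth_at_near s1; apply: nbhsW => z; rewrite scaleN1r.
Qed.

(** Finitely many steps f := (1 - l) f + l (f x) with the constant f x suffice. Where
    l = 1 the new map is constant, where the old map was smooth it stays smooth.
    Each step is taken on a set where the original f is N-close to f x, so that by
    convexity of N the error with respect to the original f stays in N, however
    many steps are made. *)
Lemma smoothing_on_compact (U Z V B : set M) (f : M -> E) (N Q : set E) :
  open U -> closed Z -> open V -> Z `<=` V -> compact B -> B `<=` U ->
  (forall y, U y -> {for y, continuous f}) ->
  (forall y, U y -> V y -> smE f y) ->
  open N -> is_convex N -> N 0 -> is_convex Q -> (forall y, U y -> Q (f y)) ->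
  exists (f' : M -> E) (D : set M),
  [/\ closed D, D `<=` U, (forall y, D y -> ~ Z y) &
      (forall y, ~ D y -> f' y = f y)] /\
  [/\ (forall y, U y -> {for y, continuous f'}),
      (forall y, U y -> smE f y -> smE f' y),
      (forall y, U y -> Q (f' y)), (forall y, U y -> N (f' y - f y)) &
      (forall y, B y -> smE f' y)].
Proof.
move=> oU cZ oV ZV cB BU cf sf oN cN N0 cQ fQ.
have bump x : exists lD : (M -> R^o) * set M, B x -> ~ V x ->
    [/\ [/\ closed lD.2, lD.2 `<=` U, (forall y, lD.2 y -> ~ Z y) &
            (forall y, lD.2 y -> N (f x - f y))],
        (forall y, smooth_at AM (id_atlas R^o) lD.1 y),
        (forall y, 0 <= lD.1 y /\ lD.1 y <= 1),
        (forall y, lD.1 y != 0 -> lD.2 y) &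
        \forall y \near x, lD.1 y = 1].
  have [[Bx nVx]|no] := pselect (B x /\ ~ V x); last first.
    by exists (fun=> 0, set0) => Bx nVx; case: no.
  have nO : nbhs x [set y | [/\ U y, ~ Z y & N (f x - f y)]].
    have n1 : \forall y \near x, U y by apply: open_nbhs_nbhs; split => //; exact: BU.
    have n2 : \forall y \near x, ~ Z y.
      have : nbhs x (~` Z) by apply: open_nbhs_nbhs; split; [exact: closed_openC|move=> /ZV].
      exact.
    have n3 : \forall y \near x, N (f x - f y).
      have cfx : (fun y => f x - f y) @ x --> f x - f x.
        exact: tvs_cvgB (cvg_cst (f x)) (cf x (BU x Bx)).
      by apply: cfx; rewrite subrr; exact: open_nbhs_nbhs.
    by near=> y; split; near: y.
  have [l [D [[_ clD DO] sl l01 lD l1]]] := smooth_bump M_corners nO.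
  by exists (l, D) => _ _; split => //; split => // y /DO[].
have [lD lDP] := choice bump.
(* nothing is to be done at points of V, where f is smooth already *)
pose G x := if `[< V x >] then V else interior [set y | (lD x).1 y = 1].
have [|s sB] := compact_finite_cover (G := G) cB.
  move=> x Bx; rewrite /G; case: asboolP => [Vx|nVx]; first exact: open_nbhs_nbhs.
  have [_ _ _ _ l1] := lDP x Bx nVx.
  by apply: nbhs_interior; exact: l1.
suff : exists (f' : M -> E) (D : set M),
  [/\ closed D, D `<=` U, (forall y, D y -> ~ Z y) &
      (forall y, ~ D y -> f' y = f y)] /\
  [/\ (forall y, U y -> {for y, continuous f'}),
      (forall y, U y -> smE f y -> smE f' y),
      (forall y, U y -> Q (f' y)), (forall y, U y -> N (f' y - f y)) &
      (forall x, x \in s -> B x -> forall y, U y -> G x y -> smE f' y)].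
  move=> [f' [D [H1 [h1 h2 h3 h4 h5]]]]; exists f', D; split => //; split => // y By.
  by have [x [xs Bx Gxy]] := sB y By; apply: (h5 x) => //; exact: BU.
elim: s {sB} => [|x s [f' [D [[clD DU DZ fD] [cf' sf' Qf' Nf' sG]]]]].
  exists f, set0; split; first by split => //; exact: closed0.
  by split => // y _; rewrite subrr.
have [[Bx nVx]|no] := pselect (B x /\ ~ V x); last first.
  exists f', D; split => //; split => // z; rewrite inE => /orP[/eqP ->|zs]; last exact: sG.
  move=> Bx y Uy; rewrite /G; case: asboolP => [Vx Vy|nVx]; last by case: no.
  by apply: sf' => //; exact: sf.
have [[clDx DxU DxZ DxN] sl l01 lDx l1] := lDP x Bx nVx.
set l := (lD x).1 in sl l01 lDx l1; set Dx := (lD x).2 in clDx DxU DxZ DxN lDx.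
pose f'' z := (1 - l z) *: f' z + l z *: f x.
have off y : ~ Dx y -> f'' y = f' y.
  move=> nDy; have -> : f'' y = (1 - l y) *: f' y + l y *: f x by [].
  have -> : l y = 0 by apply: contrapT => /eqP /lDx.
  by rewrite subr0 scale1r scale0r addr0.
have l0 y : 0 <= 1 - l y by rewrite subr_ge0; case: (l01 y).
have l0' y : 0 <= l y by case: (l01 y).
have sf'' y : smE f' y -> smE f'' y by move=> h; exact: smooth_at_interpolate.
exists f'', (D `|` Dx); split; split.
- exact: closedU.
- by move=> y [/DU|/DxU].
- by move=> y [/DZ|/DxZ].
- move=> y nD; rewrite off; first by apply: fD => Dy; apply: nD; left.
  by move=> Dy; apply: nD; right.
- move=> y Uy; have cl := proj1 (sl y).
  have c1 : {for y, continuous (fun z => 1 - l z : R^o)}.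
    exact: (tvs_cvgB (V := R^o) (cvg_cst (1 : R^o)) cl).
  exact: tvs_cvgD (tvs_cvgZ c1 (cf' y Uy)) (tvs_cvgZ cl (cvg_cst (f x))).
- by move=> y Uy sy; apply: sf''; exact: sf'.
- move=> y Uy; apply: cQ => //; [exact: Qf'|exact: fQ (BU x Bx)|].
  by rewrite subrK.
- move=> y Uy; have [Dy|nDy] := pselect (Dx y); last by rewrite off//; exact: Nf'.
  have -> : f'' y - f y = (1 - l y) *: (f' y - f y) + l y *: (f x - f y).
    rewrite !scalerBr addrACA -opprD -scalerDl subrK scale1r.
    by [].
  by apply: cN => //; [exact: Nf'|exact: DxN|rewrite subrK].
- move=> z; rewrite inE => /orP[/eqP ->|zs] Bz y Uy Gy; last first.
    by apply: sf''; exact: (sG z).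
  move: Gy; rewrite /G asboolF// => Gy.
  have sc : smE (fun _ => f x) y by apply: smooth_at_cst => //; exact: good_id_atlas.
  apply: smooth_at_near sc.
  have nE : \forall z \near y, l z = 1 by exact: Gy.
  apply: filterS nE => w lw.
  have -> : f'' w = (1 - l w) *: f' w + l w *: f x by [].
  by rewrite lw subrr scale0r add0r scale1r.
Unshelve. all: by end_near. Qed.

End LocalSmoothing.

(** * Smoothing a bundle map over one member of a cover *)

Section Smoothing.
Context {R : realType} {E : tvsType R} {K : preTopologicalGroupType}.
Context {AK : set (chart K E)} {d : nat} {M : topologicalType}.
Context {AM : set (chart M 'rV[R]_d)}.
Hypotheses (hE : hausdorff_space E) (K_lie : is_lie_group AK)
  (M_corners : is_manifold_with_corners AM).
Variables (P P' : smooth_bundle AM AK).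

Local Notation eta := (proj P).
Local Notation eta' := (proj P').
Local Notation trivP := (@trivs _ _ _ _ _ AM AK P).
Local Notation trivP' := (@trivs _ _ _ _ _ AM AK P').

Let gM : good_atlas AM. Proof. exact: corner_good_atlas. Qed.
Let gK : good_atlas AK. Proof. exact: lie_good_atlas. Qed.
Let gE : good_atlas (id_atlas E). Proof. exact: good_id_atlas. Qed.
Let ceta : continuous eta. Proof. exact: (@Defs.proj_continuous _ _ P). Qed.
Let ceta' : continuous eta'. Proof. exact: (@Defs.proj_continuous _ _ P'). Qed.

Record rep_data := RepData {
  pt : triv M P K; pt' : triv M P' K; pc : chart K E; pQ : set E }.

Definition good_data (D : rep_data) :=
  [/\ trivP (pt D), trivP' (pt' D), AK (pc D) &
      [/\ open (pQ D), is_convex (pQ D) & pQ D `<=` cfwd (pc D) @` cdom (pc D)]].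

(** The local representative takes values in a part of K that a chart maps into a
    convex set, where averages make sense. Over a compact set this is an open
    condition on the map. *)
Definition adapted (D : rep_data) (Om : P -> P') (y : M) :=
  cdom (pc D) (local_rep (pt D) (pt' D) Om y) /\
  pQ D (cfwd (pc D) (local_rep (pt D) (pt' D) Om y)).

Lemma good_cbwd D e : good_data D -> pQ D e ->
  [/\ cdom (pc D) (cbwd (pc D) e), cfwd (pc D) (cbwd (pc D) e) = e,
      {for e, continuous (cbwd (pc D))} &
      smooth_at (id_atlas E) AK (cbwd (pc D)) e].
Proof.
move=> [_ _ AKc [_ _ Qi]] Qe; have [x cx xe] := Qi e Qe.
have [hK _ _] := gK; have [_ bf _ _] := hK _ AKc.
have aK : is_atlas setT AK by case: K_lie => -[].
have s := is_atlas_smooth_cbwd aK AKc (Qi e Qe).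
split => //; last exact: (proj1 s).
- by rewrite -xe bf.
- by rewrite -xe bf.
Qed.

Section Step.
Context {I : Type}.
Variables (U : I -> set M) (D : I -> rep_data).
Hypotheses (oU : forall i, open (U i)) (lfU : lf_family U)
  (cU : forall i, compact (closure (U i)))
  (gD : forall i, good_data (D i))
  (Ut : forall i, closure (U i) `<=` tdom (pt (D i)))
  (Ut' : forall i, closure (U i) `<=` tdom (pt' (D i))).

Definition all_adapted (Om : P -> P') :=
  forall i y, closure (U i) y -> adapted (D i) Om y.

Section OneStep.
Variables (Om : P -> P') (i : I).
Hypotheses (mO : bundle_morphism Om) (aO : all_adapted Om).

Let t := pt (D i).
Let t' := pt' (D i).
Let c := pc (D i).
Let f y := cfwd c (local_rep t t' Om y).
Let Pt : trivP t. Proof. by have [] := gD i. Qed.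
Let Pt' : trivP' t'. Proof. by have [] := gD i. Qed.
Let AKc : AK c. Proof. by have [] := gD i. Qed.

Let cf y : closure (U i) y -> {for y, continuous f}.
Proof.
move=> cy; have [hK _ _] := gK; have [_ _ cc _] := hK _ AKc.
have [cd _] := aO cy.
exact: (cvg_comp _ _ (local_rep_continuous Pt Pt' mO (Ut cy) (Ut' cy))
  (cc _ cd)).
Qed.

Let fQ y : closure (U i) y -> pQ (D i) (f y).
Proof. by move=> cy; have [] := aO cy. Qed.

Let fK y : closure (U i) y -> cbwd c (f y) = local_rep t t' Om y.
Proof.
move=> cy; have [hK _ _] := gK; have [_ bf _ _] := hK _ AKc.
by have [cd _] := aO cy; rewrite /f bf.
Qed.

(** The value over z.1, in the trivializations of index j, of the map obtained from
    Om by adding z.2 in the chart of index i. *)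
Let moved j (z : M * E) : K :=
  (tfwd (pt' (D j)) (tbwd t' (z.1, (cbwd c (f z.1 + z.2) *
     (tfwd t (tbwd (pt (D j)) (z.1, 1%g))).2)%g))).2.

Let moved0 j x : closure (U i) x -> closure (U j) x ->
  moved j (x, 0) = local_rep (pt (D j)) (pt' (D j)) Om x.
Proof.
move=> ix jx; rewrite /moved /= addr0 fK// /local_rep.
have [Pj Pj' _ _] := gD j; have tj := trivs_triv Pj.
have ej : eta (tbwd (pt (D j)) (x, 1%g)) = x by rewrite (triv_bwd_eta tj)//; exact: Ut.
rewrite -(@of_local_repK _ _ _ _ _ _ _ P P' t t' Pt Pt' Om (tbwd (pt (D j)) (x, 1%g))) ?ej//.
- by rewrite /of_local_rep ej.
- exact: Ut.
- exact: Ut'.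
Qed.

Let moved_continuous j x : closure (U i) x -> closure (U j) x ->
  {for (x, 0), continuous (moved j)}.
Proof.
move=> ix jx; have [Pj Pj' _ _] := gD j.
have tj := trivs_triv Pj; have tj' := trivs_triv Pj'.
have ti := trivs_triv Pt; have ti' := trivs_triv Pt'.
have FF : Filter (nbhs (x, 0 : E)) by exact: nbhs_filter.
have cx : (fun z : M * E => z.1) @ (x, 0 : E) --> x by exact: cvg_fst.
have c1 : (fun z : M * E => f z.1 + z.2) @ (x, 0 : E) --> f x.
  rewrite -[X in _ --> X]addr0; apply: tvs_cvgD; last exact: cvg_snd.
  exact: (cvg_comp _ _ cx (cf ix)).
have [_ _ cb _] := good_cbwd (gD i) (fQ ix).
have c2 := cvg_comp _ _ c1 cb.
have c3 : (fun z : M * E => (z.1, 1%g : K)) @ (x, 0 : E) --> (x, 1%g : K).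
  by apply: cvg_pair_nbhs => //; exact: cvg_cst.
have c4 := cvg_comp _ _ c3 (@triv_bwd_continuous _ _ _ _ _ _ tj x 1%g (Ut jx)).
have ej : eta (tbwd (pt (D j)) (x, 1%g)) = x by rewrite (triv_bwd_eta tj)//; exact: Ut.
have tq : tdom t (eta (tbwd (pt (D j)) (x, 1%g))) by rewrite ej; exact: Ut.
pose k (z : M * E) := (tfwd t (tbwd (pt (D j)) (z.1, 1%g))).2.
have c5 : k @ (x, 0 : E) --> k (x, 0).
  exact: (cvg_comp _ _ (cvg_comp _ _ c4 (triv_fwd_continuous ti ceta tq)) cvg_snd).
pose m (z : M * E) := (cbwd c (f z.1 + z.2) * k z)%g.
have c6 : m @ (x, 0 : E) --> (cbwd c (f x) * k (x, 0%R))%g.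
  exact: (cvg_comp _ _ (cvg_pair_nbhs (FG := FF) c2 c5)
    (@continuous_mulg _ _ _ _ hE K_lie (_, _))).
have c7 : (fun z => tbwd t' (z.1, m z)) @ (x, 0 : E) -->
    tbwd t' (x, (cbwd c (f x) * k (x, 0%R))%g).
  exact: (cvg_comp _ _ (cvg_pair_nbhs (FG := FF) cx c6)
    (@triv_bwd_continuous _ _ _ _ _ _ ti' _ _ (Ut' ix))).
have tq' : tdom (pt' (D j)) (eta' (tbwd t' (x, (cbwd c (f x) * k (x, 0%R))%g))).
  by rewrite (triv_bwd_eta ti'); [exact: Ut'|exact: Ut'].
have c8 := cvg_comp _ _ c7 (triv_fwd_continuous tj' ceta' tq').
rewrite /prop_for /continuous_at {2}/moved /= addr0.
exact: (cvg_comp _ _ c8 cvg_snd).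
Qed.

(** Tube lemma over the compact closure of U i. By local finiteness, near each
    point only finitely many of the conditions are to be met, and each of them is
    open. *)
Let moved_adapted : exists N : set E, [/\ open N, N 0, is_convex N &
  forall e y j, N e -> closure (U i) y -> closure (U j) y ->
    cdom (pc (D j)) (moved j (y, e)) /\ pQ (D j) (cfwd (pc (D j)) (moved j (y, e)))].
Proof.
pose A j := [set k : K | cdom (pc (D j)) k /\ pQ (D j) (cfwd (pc (D j)) k)].
have nA j k : A j k -> nbhs k (A j).
  move=> [ck Qk]; have [hK _ _] := gK; have [_ _ AKj [oQ _ _]] := gD j.
  have [oc _ cc _] := hK _ AKj.
  apply: filterI; first exact: open_nbhs_nbhs.
  by apply: (cc k ck); exact: open_nbhs_nbhs.
have nN0 : \forall e \near (0 : E), closure (U i) `<=`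
    (fun y => forall j, closure (U j) y -> A j (moved j (y, e))).
  apply: (proj1 (compact_near_coveringP _) (cU (i := i)) E (nbhs (0 : E))
    (fun e y => forall j, closure (U j) y -> A j (moved j (y, e)))) => x ix.
  have [W nW finW] := closure_lf_closure lfU x.
  have FF : Filter (nbhs (x, 0 : E)) by exact: nbhs_filter.
  have h1 : \forall z \near (x, 0 : E), forall j,
      [set j | closure (U j) `&` W !=set0] j -> closure (U j) z.1 -> A j (moved j z).
    apply: (@finite_near _ _ (nbhs (x, 0 : E)) FF _
      (fun j z => closure (U j) z.1 -> A j (moved j z)) finW) => j _.
    have [jx|njx] := pselect (closure (U j) x).
      have := moved_continuous ix jx.
      have : A j (moved j (x, 0)) by rewrite moved0//; exact: aO.
      by move=> /nA nA0 /(_ _ nA0); apply: (@filterS _ (nbhs (x, 0 : E)) FF) => z Az _.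
    have : \forall z \near (x, 0 : E), ~ closure (U j) z.1.
      have n : nbhs x (~` closure (U j)).
        by apply: open_nbhs_nbhs; split => //; apply: closed_openC; exact: closed_closure.
      exact: (@cvg_fst _ _ (nbhs x) (nbhs (0 : E)) _ _ n).
    by apply: (@filterS _ (nbhs (x, 0 : E)) FF) => z nz /nz.
  have h2 : \forall z \near (x, 0 : E), W z.1.
    exact: (@cvg_fst _ _ (nbhs x) (nbhs (0 : E)) _ _ nW).
  have : \forall z \near (x, 0 : E), forall j, closure (U j) z.1 -> A j (moved j z).
    apply: (@filterS2 _ (nbhs (x, 0 : E)) FF _ _ _ _ h1 h2) => z h Wz j jz.
    by apply: h => //; exists z.1.
  move=> [[W1 W2] /= [n1 n2] W12].
  exists (W1, W2); first by split.
  by move=> [y e] /= [Wy We] j jy; exact: (W12 (y, e) (conj Wy We)).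
have [N [oN N0' cN NN]] := convex_nbhs nN0.
exists N; split => // e y j Ne iy jy.
exact: (NN e Ne y iy j jy).
Qed.

(** The modification over U i is chosen so small that the map remains adapted to all
    members of the cover; this is what allows the steps to go on for ever. *)
Lemma smoothing_step (Z V B : set M) : closed Z -> open V -> Z `<=` V ->
  closed B -> B `<=` U i -> (forall x, V x -> smooth_over Om x) ->
  exists Om' : P -> P',
  [/\ bundle_morphism Om', all_adapted Om',
      (forall p, ~ U i (eta p) -> Om p = Om' p),
      (forall p, Z (eta p) -> Om p = Om' p) &
      (forall x, smooth_over Om x -> smooth_over Om' x) /\
      (forall x, B x -> smooth_over Om' x)].
Proof.
move=> cZ oV ZV cB BU sO.
have [N [oN N0 cN HN]] := moved_adapted.
have [_ _ _ [oQ cQ Qi]] := gD i.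
have Ucl y : U i y -> closure (U i) y by exact: subset_closure.
have ti := trivs_triv Pt; have ti' := trivs_triv Pt'.
have smf y : U i y -> smooth_over Om y -> smooth_at AM (id_atlas E) f y.
  move=> Uy sy; have [cd _] := aO (Ucl y Uy).
  have [hK _ _] := gK.
  apply: (smooth_at_comp gK _ (smooth_at_cfwd AKc (hK _ AKc) cd)).
  apply: (local_rep_smooth hE K_lie M_corners Pt Pt') => //;
    [exact: Ut (Ucl y Uy)|exact: Ut' (Ucl y Uy)|].
  by apply: sy; rewrite (triv_bwd_eta ti)//; exact: Ut (Ucl y Uy).
have cpB : compact B.
  by apply: (subclosed_compact cB (cU (i := i))) => y /BU /Ucl.
have [f' [S [[clS SU SZ fS] [cf' sf' Qf' Nf' sB]]]] :=
  @smoothing_on_compact R E d M AM M_corners (U i) Z V B f N (pQ (D i))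
    (oU i) cZ oV ZV cpB BU (fun y Uy => cf (Ucl y Uy))
    (fun y Uy Vy => smf y Uy (sO y Vy)) oN cN N0 cQ (fun y Uy => fQ (Ucl y Uy)).
pose g y := cbwd c (f' y).
have cg y : U i y -> {for y, continuous g}.
  move=> Uy; have [_ _ cb _] := good_cbwd (gD i) (Qf' y Uy).
  exact: (cvg_comp _ _ (cf' y Uy) cb).
have sg y : U i y -> smooth_at AM (id_atlas E) f' y -> smooth_at AM AK g y.
  move=> Uy sy; have [_ _ _ sb] := good_cbwd (gD i) (Qf' y Uy).
  exact: (smooth_at_comp gE sy sb).
have gOm y : U i y -> ~ S y -> g y = local_rep t t' Om y.
  by move=> Uy nSy; rewrite /g fS// fK//; exact: Ucl.
have Uit : U i `<=` tdom t by move=> y /Ucl; exact: Ut.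
have Uit' : U i `<=` tdom t' by move=> y /Ucl; exact: Ut'.
pose Om' := reglue t t' Om (U i) g.
have Om'E p : ~ S (eta p) -> Om p = Om' p.
  by move=> nS; rewrite /Om' (@reglue_off _ _ _ _ _ _ _ P P' t t' Pt Pt' Om (U i) S g).
exists Om'; split.
- exact: (@reglue_morphism _ _ _ _ _ _ _ hE K_lie P P' t t' Pt Pt' Om (U i) S g).
- move=> j y jy; have [Pj Pj' _ _] := gD j; have tj := trivs_triv Pj.
  have ej : eta (tbwd (pt (D j)) (y, 1%g)) = y by rewrite (triv_bwd_eta tj)//; exact: Ut.
  have [Sy|nSy] := pselect (S y); last first.
    by rewrite /adapted /local_rep -Om'E ?ej//; exact: aO.
  have Uy := SU y Sy.
  (* over S the new map is Om moved by the small vector f' y - f y *)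
  have := HN (f' y - f y) y j (Nf' y Uy) (Ucl y Uy) jy.
  rewrite /adapted /local_rep /Om' reglue_in ?ej// /of_local_rep ej /moved /=.
  by rewrite [f y + _]addrC subrK.
- by move=> p nU; apply: Om'E => /SU.
- by move=> p Zp; apply: Om'E => /SZ.
split=> x; last first.
  move=> Bx; apply: (@reglue_smooth_in _ _ _ _ _ _ _ hE K_lie M_corners P P' t t') => //.
  - exact: BU.
  - by apply: sg; [exact: BU|exact: sB].
move=> sx; have [Ux|nUx] := pselect (U i x).
  apply: (@reglue_smooth_in _ _ _ _ _ _ _ hE K_lie M_corners P P' t t') => //.
  by apply: sg => //; apply: sf' => //; exact: smf.
apply: (@reglue_smooth_off _ _ _ _ _ _ _ P P' t t' Pt Pt' Om (U i) S g) => //.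
by move=> /SU.
Qed.

End OneStep.
End Step.
End Smoothing.

(** * Globalization *)

Section Globalization.
Context {R : realType} {E : tvsType R} {K : preTopologicalGroupType}.
Context {AK : set (chart K E)} {d : nat} {M : topologicalType}.
Context {AM : set (chart M 'rV[R]_d)}.
Hypotheses (hE : hausdorff_space E) (K_lie : is_lie_group AK)
  (M_corners : is_manifold_with_corners AM).
Variables (P P' : smooth_bundle AM AK).
Local Notation eta := (proj P).
Local Notation eta' := (proj P').
Local Notation trivP := (@trivs _ _ _ _ _ AM AK P).
Local Notation trivP' := (@trivs _ _ _ _ _ AM AK P').
Let ceta : continuous eta. Proof. exact: (@Defs.proj_continuous _ _ P). Qed.

Lemma bundle_morphism_local (Om : P -> P') :
  (forall x : M, exists2 Om1 : P -> P', bundle_morphism Om1 &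
     \forall y \near x, forall p, eta p = y -> Om p = Om1 p) ->
  bundle_morphism Om.
Proof.
move=> loc; split; first split.
- move=> p; have [Om1 [[cO _] _] nO] := loc (eta p).
  rewrite /continuous_at (nbhs_singleton nO)//.
  refine (cvg_trans _ (cO p)); apply: near_eq_cvg.
  have h : \forall q \near p, forall p0, eta p0 = eta q -> Om p0 = Om1 p0.
    exact: (@ceta p _ nO).
  by apply: filterS h => q /(_ q erefl).
- move=> p k; have [Om1 [[_ aO] _] /nbhs_singleton nO] := loc (eta p).
  by rewrite !nO ?proj_act.
- move=> p; have [Om1 [_ eO] /nbhs_singleton nO] := loc (eta p).
  by rewrite nO.
Qed.

Lemma smooth_over_local (Om Om1 : P -> P') (x : M) :
  (\forall y \near x, forall p, eta p = y -> Om1 p = Om p) ->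
  smooth_over Om1 x -> smooth_over Om x.
Proof.
move=> nO sO p px; apply: smooth_at_near (sO p px).
rewrite -px in nO.
have h : \forall q \near p, forall p0, eta p0 = eta q -> Om1 p0 = Om p0.
  exact: (@ceta p _ nO).
by apply: filterS h => q /(_ q erefl).
Qed.

Section Zorn.
Context {I : Type}.
Variables (U B : I -> set M) (D : I -> rep_data P P').
Hypotheses (oU : forall i, open (U i)) (lfU : lf_family U)
  (cU : forall i, compact (closure (U i)))
  (gD : forall i, good_data (D i))
  (Ut : forall i, closure (U i) `<=` tdom (pt (D i)))
  (Ut' : forall i, closure (U i) `<=` tdom (pt' (D i)))
  (clB : forall i, closed (B i)) (BU : forall i, B i `<=` U i)
  (cB : forall x, exists i, B i x).
Variables (Om0 : P -> P') (Z V : set M).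
Hypotheses (cZ : closed Z) (oV : open V) (ZV : Z `<=` V)
  (mO0 : bundle_morphism Om0) (aO0 : all_adapted U D Om0)
  (sO0 : forall x, V x -> smooth_over Om0 x).

(** A stage consists of the indices already treated and the map reached. *)
Definition smoothing_stage (s : set I * (P -> P')) :=
  [/\ bundle_morphism s.2, all_adapted U D s.2,
      (forall p, Z (eta p) -> Om0 p = s.2 p),
      (forall x, V x -> smooth_over s.2 x) &
      (forall i x, s.1 i -> B i x -> smooth_over s.2 x)].

Let T := {s : set I * (P -> P') | smoothing_stage s}.
Let ix (s : T) : set I := (sval s).1.
Let mp (s : T) : P -> P' := (sval s).2.

(** A later stage may change the map only over the members of the cover treated in
    between. By local finiteness a chain is then locally constant from some stage
    on, which is how it gets an upper bound. *)
Let ext (s s' : T) : Prop := ix s `<=` ix s' /\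
  forall p, (forall j, ix s' j -> ~ ix s j -> ~ U j (eta p)) -> mp s p = mp s' p.

Let ext_refl s : ext s s. Proof. by split. Qed.

Let ext_trans r s t : ext r s -> ext s t -> ext r t.
Proof.
move=> [rs rsE] [st stE]; split; first exact: subset_trans st.
move=> p pE; rewrite rsE => [|j sj nrj]; last by apply: pE => //; exact: st.
by apply: stE => j tj nsj; apply: pE => // /rs.
Qed.

Let ext_antisym s t : ext s t -> ext t s -> s = t.
Proof.
move=> [st stE] [ts _].
have e1 : ix s = ix t by apply/seteqP.
have e2 : mp s = mp t by apply/funext => p; apply: stE => j tj; case; exact: ts.
move: s t e1 e2 {st stE ts} => [[J f] Hs] [[J' f'] Hs']; rewrite /ix /mp /= => e1 e2.
by subst J' f'; congr exist; exact: Prop_irrelevance.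
Qed.

Let stage0 : T.
Proof. by exists (set0, Om0); split. Defined.

Section Chain.
Variable A : set T.
Hypotheses (totA : forall s t, A s -> A t -> ext s t \/ ext t s) (A0 : A !=set0).

Let J := \bigcup_(s in A) ix s.

Let captures (s : T) (x : M) := forall j, U j x -> J j -> ix s j.

Let captures_eq s s' p : A s -> A s' -> captures s (eta p) -> captures s' (eta p) ->
  mp s p = mp s' p.
Proof.
move=> As As' c c'; have [[_ e]|[_ e]] := totA As As'.
  by apply: e => j s'j nsj Ujp; apply: nsj; apply: c => //; exists s'.
by apply/esym; apply: e => j sj ns'j Ujp; apply: ns'j; apply: c' => //; exists s.
Qed.

Let finite_captured (S : set I) : finite_set S ->
  exists2 s, A s & forall j, S j -> J j -> ix s j.
Proof.
move=> /(@finite_seqP {classic I})[r ->]; elim: r => [|i r [s As sr]].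
  by have [s As] := A0; exists s.
have [[s' As' s'i]|nJ] := pselect (J i); last first.
  exists s => // j; rewrite /= inE => /orP[/eqP -> //|jr]; exact: sr.
have [[ss' _]|[s's _]] := totA As As'.
  exists s' => // j; rewrite /= inE => /orP[/eqP -> //|jr] Jj.
  by apply: ss'; exact: sr.
exists s => // j; rewrite /= inE => /orP[/eqP -> _|jr]; [exact: s's|exact: sr].
Qed.

Let local_stage (x : M) : exists s, A s /\ \forall y \near x, captures s y.
Proof.
have [N nN /finite_captured[s As sN]] := lfU x.
exists s; split => //; apply: filterS nN => y Ny j Uy Jj.
by apply: sN => //; exists y.
Qed.

Let sx := projT1 (choice local_stage).
Let sxA x : A (sx x). Proof. exact: (proj1 (projT2 (choice local_stage) x)). Qed.
Let sx_near x : \forall y \near x, captures (sx x) y.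
Proof. exact: (proj2 (projT2 (choice local_stage) x)). Qed.

Let glued (p : P) : P' := mp (sx (eta p)) p.

Let gluedE s p : A s -> captures s (eta p) -> mp s p = glued p.
Proof.
move=> As cs; apply: captures_eq => //.
exact: nbhs_singleton (sx_near (eta p)).
Qed.

Let glued_near x : \forall y \near x, forall p, eta p = y -> mp (sx x) p = glued p.
Proof. by move: (sx_near x); apply: filterS => y cy p py; apply: gluedE; rewrite ?py. Qed.

Let glued_stage : smoothing_stage (J, glued).
Proof.
have sm x : smooth_over (mp (sx x)) x -> smooth_over glued x.
  exact: smooth_over_local (glued_near x).
split => /=.
- apply: bundle_morphism_local => x; exists (mp (sx x)).
    by have [] := svalP (sx x).
  by move: (glued_near x); apply: filterS => y h p /h.
- move=> i y iy; have [_ /(_ i y iy) + _ _ _] := svalP (sx y).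
  rewrite /adapted /local_rep; set q := tbwd _ _.
  have qy : eta q = y.
    have [Pt _ _ _] := gD i; have tt := trivs_triv Pt.
    by rewrite (triv_bwd_eta tt)//; exact: Ut iy.
  by rewrite -[(sval (sx y)).2 q]/(mp (sx y) q) (nbhs_singleton (glued_near y) q qy).
- by move=> p Zp; have [_ _ + _ _] := svalP (sx (eta p)); apply.
- by move=> x Vx; apply: sm; have [_ _ _ + _] := svalP (sx x); apply.
- move=> i x Ji Bx; apply: sm; have [_ _ _ _] := svalP (sx x); apply; last exact: Bx.
  by apply: (nbhs_singleton (sx_near x)) => //; exact: BU.
Qed.

Lemma chain_ub : exists t, forall s, A s -> ext s t.
Proof.
exists (exist _ (J, glued) glued_stage) => s As; split; first by move=> j sj; exists s.
move=> p pE; apply: gluedE => // j Uj Jj.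
by apply: contrapT => nsj; exact: (pE j Jj nsj).
Qed.

End Chain.

Lemma globalize_smoothing : exists Om : P -> P',
  [/\ bundle_morphism Om, (forall p, Z (eta p) -> Om0 p = Om p) &
      forall x, smooth_over Om x].
Proof.
have [|||A totA|s smax] := @Zorn T (fun s t => `[< ext s t >]).
- by move=> t; apply/asboolP.
- by move=> r s t /asboolP rs /asboolP st; apply/asboolP; exact: ext_trans st.
- by move=> s t /asboolP st /asboolP ts; exact: ext_antisym.
- have [A0|/set0P A0] := eqVneq A set0; first by exists stage0 => s; rewrite A0.
  have tot s t : A s -> A t -> ext s t \/ ext t s.
    by move=> As At; have [/asboolP|/asboolP] := totA s t As At; [left|right].
  have [u uE] := chain_ub tot A0.
  by exists u => s As; apply/asboolP; exact: uE.
have [mO aO ZO VO BO] := svalP s.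
have full i : ix s i.
  apply: contrapT => nsi.
  have [Om' [mO' aO' UO' ZO' [kO' BO']]] := smoothing_step hE K_lie M_corners oU lfU
    cU gD Ut Ut' mO aO cZ oV ZV (@clB i) (@BU i) VO.
  have st' : smoothing_stage (ix s `|` [set i], Om').
    split => //=.
    - by move=> p Zp; rewrite ZO// ZO'.
    - by move=> x Vx; apply: kO'; exact: VO.
    - by move=> j x [sj|->] Bx; [apply: kO'; exact: BO sj Bx|exact: BO'].
  have : ext s (exist _ _ st').
    split; first by move=> j; left.
    move=> p pE; apply: UO'; apply: pE => //; by right.
  move=> /asboolP /smax e; apply: nsi; rewrite -e; by right.
exists (mp s); split => // x; have [i Bix] := cB x.
exact: BO (full i) Bix.
Qed.

End Zorn.

End Globalization.

Section Cover.
Context {R : realType} {E : tvsType R} {K : preTopologicalGroupType}.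
Context {AK : set (chart K E)} {d : nat} {M : topologicalType}.
Context {AM : set (chart M 'rV[R]_d)}.
Hypotheses (hE : hausdorff_space E) (K_lie : is_lie_group AK)
  (M_corners : is_manifold_with_corners AM).
Variables (P P' : smooth_bundle AM AK).

Definition adapted_set (Om : P -> P') (D : rep_data P P') (G : set M) :=
  [/\ good_data D, compact (closure G), closure G `<=` tdom (pt D),
      closure G `<=` tdom (pt' D) & forall y, closure G y -> adapted D Om y].

(** Centre a convex chart neighborhood at the value of the local representative. *)
Lemma adapted_set_near (Om : P -> P') x : bundle_morphism Om ->
  exists G, [/\ open G, G x & exists D, adapted_set Om D G].
Proof.
move=> mO; have gK := lie_good_atlas hE K_lie.
have [t Pt tx] := trivs_cover P x; have [t' Pt' t'x] := trivs_cover P' x.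
have [hK cK _] := gK.
have [c Ac cx] := cK (local_rep t t' Om x).
have [oc _ cc _] := hK c Ac.
have [_ [aK _ _]] : is_manifold AK by case: K_lie.
have [_ [W oW WE] _ _ _] := aK c Ac; rewrite setIT in WE.
have nW : nbhs (cfwd c (local_rep t t' Om x)) (cfwd c @` cdom c).
  by rewrite WE; apply: open_nbhs_nbhs; split => //; rewrite -WE; exists (local_rep t t' Om x).
have [Q [oQ Qx cQ Qi]] := convex_nbhs nW.
pose D := RepData t t' c Q.
have cg := local_rep_continuous Pt Pt' mO tx t'x.
have nO : nbhs x [set y | [/\ tdom t y, tdom t' y & adapted D Om y]].
  have n1 : \forall y \near x, tdom t y.
    by apply: open_nbhs_nbhs; split => //; exact: (triv_open (trivs_triv Pt)).
  have n2 : \forall y \near x, tdom t' y.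
    by apply: open_nbhs_nbhs; split => //; exact: (triv_open (trivs_triv Pt')).
  have n3 : \forall y \near x, cdom c (local_rep t t' Om y).
    by apply: cg; exact: open_nbhs_nbhs.
  have n4 : \forall y \near x, Q (cfwd c (local_rep t t' Om y)).
    apply: (cg [set k | Q (cfwd c k)]); apply: (cc _ cx); exact: open_nbhs_nbhs.
  near=> y; split; [by near: y|by near: y|split; by near: y].
have [G [oG Gx cG GO]] := corner_regular M_corners nO.
exists G; split => //; exists D; split => //.
- by move=> y /GO[].
- by move=> y /GO[].
- by move=> y /GO[].
Unshelve. all: by end_near. Qed.

Lemma adapted_setS (Om : P -> P') D G G' : G' `<=` G -> adapted_set Om D G ->
  adapted_set Om D G'.
Proof.
move=> G'G [gD cG Gt Gt' aG]; have clS := closureS G'G.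
split => //.
- exact: (subclosed_compact (@closed_closure _ _) cG clS).
- exact: subset_trans Gt.
- exact: subset_trans Gt'.
- by move=> y /clS; exact: aG.
Qed.

End Cover.

Theorem theorem2p12 (R : realType) (E : tvsType R) (E_hausdorff : hausdorff_space E)
  (K : preTopologicalGroupType) (AK : set (chart K E)) (K_lie : is_lie_group AK)
  (d : nat) (M : topologicalType) (AM : set (chart M 'rV[R]_d))
  (M_corners : is_manifold_with_corners AM) (M_connected : connected [set: M])
  (P P' : smooth_bundle AM AK)
  (Om : P -> P') (Om_equiv : bundle_equivalence Om)
  (C : set M) (C_closed : closed C)
  (Om_smooth : exists W : set P, [/\ open W, proj P @^-1` C `<=` W &
     smooth_map_on (bundle_atlas P) (bundle_atlas P') W Om]) :
  exists (T : set M) (Om' : P -> P'),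
    [/\ open T, C `<=` T, smooth_bundle_equivalence Om' &
        forall p : P, T (proj P p) -> Om p = Om' p].
Proof.
have mO : bundle_morphism Om by case: Om_equiv.
have hrE : hausdorff_space ('rV[R]_d * E)%type.
  by apply: hausdorff_pair => //; exact: norm_hausdorff.
have gP := bundle_good_atlas E_hausdorff K_lie M_corners P.
have gP' := bundle_good_atlas E_hausdorff K_lie M_corners P'.
have [W [oW CW sW]] := Om_smooth.
(* V is an open set over which Om is smooth; nothing changes over the closure of T *)
pose V := interior [set x | smooth_over Om x].
have oV : open V by exact: open_interior.
have CV : C `<=` V.
  move=> x Cx.
  have [t Pt tx] := trivs_cover P x; have [t' Pt' t'x] := trivs_cover P' x.
  have tt := trivs_triv Pt; have tt' := trivs_triv Pt'.
  have n1 : \forall y \near x, tdom t y.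
    by apply: open_nbhs_nbhs; split => //; exact: (triv_open tt).
  have n2 : \forall y \near x, tdom t' y.
    by apply: open_nbhs_nbhs; split => //; exact: (triv_open tt').
  have n3 : \forall y \near x, W (tbwd t (y, 1%g)).
    have [cs _] := smooth_at_section E_hausdorff K_lie M_corners Pt tx.
    apply: cs; apply: open_nbhs_nbhs; split => //; apply: CW.
    by rewrite /= (triv_bwd_eta tt).
  rewrite /V /interior; near=> y.
  have ty : tdom t y by near: y.
  have t'y : tdom t' y by near: y.
  apply: (smooth_over_section E_hausdorff K_lie M_corners Pt Pt' mO ty t'y).
  apply: (smooth_map_on_at hrE gP gP' oW _ sW).
  by near: y.
have pM : paracompact M by case: M_corners.
have regM (x : M) O : nbhs x O -> exists G, [/\ open G, G x & closure G `<=` O].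
  by move=> /(corner_regular M_corners)[G [oG Gx _ GO]]; exists G.
have [T [oT CT TV]] := closed_open_between pM regM C_closed oV CV.
have [UU [oUU cUU lUU gUU]] := refine_cover pM
  (fun x => adapted_set_near E_hausdorff K_lie M_corners x mO).
have [B [clB BU cB]] := shrink_cover pM regM oUU cUU.
pose I := {G | UU G}.
have /choice[D DP] : forall i : I, exists D, adapted_set Om D (sval i).
  move=> [G UG]; have [G' [D aD] GG'] := gUU G UG.
  by exists D; exact: adapted_setS aD.
have [Om' [mO' TO' sO']] : exists Om' : P -> P', [/\ bundle_morphism Om',
    (forall p, closure T (proj P p) -> Om p = Om' p) & forall x, smooth_over Om' x].
  apply: (@globalize_smoothing R E K AK d M AM E_hausdorff K_lie M_corners P P' I
    (fun i => sval i) (fun i => B (sval i)) D _ _ _ _ _ _ _ _ _ Om (closure T) V) => //.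
  - by move=> [G UG]; exact: oUU.
  - exact: locally_finite_lf.
  - by move=> i; have [] := DP i.
  - by move=> i; have [] := DP i.
  - by move=> i; have [] := DP i.
  - by move=> i; have [] := DP i.
  - by move=> [G UG]; exact: clB.
  - by move=> [G UG]; exact: BU.
  - move=> x; have : (\bigcup_(G in UU) B G) x by rewrite cB.
    by move=> [G UG BGx]; exists (exist _ G UG).
  - exact: closed_closure.
  - by move=> i y; have [_ _ _ _] := DP i; apply.
  - by move=> x; exact: interior_subset.
exists T, Om'; split => //; last by move=> p Tp; apply: TO'; exact: subset_closure.
split; first exact: bundle_morphism_equivalence.
by apply: smooth_at_map_on => // p; exact: sO'.
Unshelve. all: by end_near. Qed.
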